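(* Assume (A1)–(A8). Then for every $L>0$ there exists $\lambda(L)\le0$ such that $\mathcal J$ is $\lambda(L)$-convex along geodesics in $(\mathcal P_2(\Omega_L),\mathcal W_2)$; that is, for every geodesic $\gamma:[0,1]\to\mathcal P_2(\Omega_L)$ and every $t\in[0,1]$, $$\mathcal J(\gamma_t)\le(1-t)\mathcal J(\gamma_0)+t\mathcal J(\gamma_1)-\frac{\lambda(L)}2t(1-t)\mathcal W_2^2(\gamma_0,\gamma_1).$$
   Context: Let $\mathcal C$ be a separable Banach space, $\mathcal M=\mathcal C^*$ its topological dual with the dual norm, and $Y$ a Hilbert space. Let $K:\mathcal M\to Y$, $\mathcal F:Y\to\mathbb R$, $\mathcal R:\mathcal M\to[0,+\infty]$. Put $\mathrm{Dom}(\mathcal R):=\{u\in\mathcal M:\mathcal R(u)<+\infty\}$. Let $B:=\{u\in\mathcal M:\mathcal R(u)\le1\}$ and let $\tilde{\mathcal B}:=\overline{\mathrm{Ext}(B)}^{*}$ be the weak$^*$-closure of its set of extremal points. Fix a (nonempty) weak$^*$-closed subset $\mathcal B\subset\tilde{\mathcal B}$ and a metric $d_{\mathcal B}$ metrizing the weak$^*$-convergence on $\mathcal B$, such that $(\mathcal B,d_{\mathcal B})$ is geodesically complete, i.e. any two points are joined by a geodesic; a geodesic in a metric space $(X,d)$ is a curve $\gamma:[0,1]\to X$ with $d(\gamma_s,\gamma_t)=|s-t|d(\gamma_0,\gamma_1)$ for all $s,t$. Assumptions: (A1) $K$ is linear and weak$^*$-to-weak continuous. (A2) $\mathcal F$ is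 bounded from below, convex, and twice Fréchet differentiable on $Y$. (A3) $\mathcal R$ is convex, weak$^*$-lower semicontinuous and positively one-homogeneous: $\mathcal R(\lambda u)=\lambda\mathcal R(u)$ for all $\lambda\ge0$, $u\in\mathcal M$. (A4) For every $\alpha\ge0$ the sublevel set $\{u\in\mathcal M:\mathcal R(u)\le\alpha\}$ is weak$^*$-compact. (A5) $K$ is sequentially weak$^*$-to-strong continuous on $\mathrm{Dom}(\mathcal R)$. (A6) (no loss of mass) For every $n\in\mathbb N$, $\alpha^1,\dots,\alpha^n\ge0$ and $u^1,\dots,u^n\in\mathcal B$: $\mathcal R(\sum_j\alpha^ju^j)=\sum_j\alpha^j\mathcal R(u^j)$. (A7) $0\notin\mathcal B$. (A8) There is a constant $C=C(K,\mathcal B)>0$ such that for $m\in\{1,2\}$ and all geodesics $u_t:[0,1]\to\mathcal B$, $\sup_{t\in[0,1]}\big\|\frac{d^m}{dt^m}K(u_t)\big\|_Y\le C\,d_{\mathcal B}^m(u_0,u_1)$, where the derivatives (assumed to exist) are understood weakly, i.e. tested against elements of $Y$. Notation: $\Omega_L:=[0,L]\times\mathcal B$ with metric $d_\Omega((c,u),(\tilde c,\tilde u)):=(|c-\tilde c|^2+d_{\mathcal B}^2(u,\tilde u))^{1/2}$ (a compact metric space); $\mathcal P_2(\Omega_L)$ is the set of Borel probability measures on $\Omega_L$ with the 2-Wasserstein distance $\mathcal W_2$ induced by $d_\Omega$; and for $\nu\in\mathcal P_2(\Omega_L)$ $$\mathcal J(\nu):=\mathcal F\Big(\int_{\Omega_L}c^2Ku\,d\nu(c,u)\Big)+\int_{\Omega_L}c^2\,d\nu(c,u).$$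 *)

(* Defs.v *)
From HB Require Import structures.
From mathcomp Require Import all_boot all_order all_algebra.
From mathcomp Require Import sesquilinear.
From mathcomp Require Import all_classical all_reals all_analysis.

Set Implicit Arguments.
Unset Strict Implicit.
Unset Printing Implicit Defensive.

Import Order.TTheory GRing.Theory Num.Theory.
Import numFieldNormedType.Exports.

Local Open Scope classical_set_scope.
Local Open Scope ring_scope.

Section dual_def.
Context {R : realType} (V : normedModType R).

Definition dual_pred : {pred (V -> R^o)} :=
  mem [set f : V -> R^o | linear f /\ continuous f].

Fact dual_submod_closed : submod_closed dual_pred.
Proof.
split=> [|a f g].
  rewrite inE; split=> [k x y|]; first by rewrite /= scaler0 addr0.
  exact: cst_continuous.
rewrite !inE => -[lf cf] [lg cg]; split=> [k x y|x].
  rewrite /= !fctE lf lg; rewrite !scalerDr !scalerA (mulrC a k).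
  by rewrite -!addrA; congr (_ + _); rewrite addrCA.
apply: cvgD; last exact: cg.
by apply: cvgZl_tmp; exact: cf.
Qed.

HB.instance Definition _ :=
  GRing.isSubmodClosed.Build R (V -> R^o) dual_pred dual_submod_closed.

Record dual := Dual {
  dual_fun :> V -> R^o ;
  dual_funP : dual_fun \in dual_pred }.

HB.instance Definition _ := [isSub for dual_fun].
HB.instance Definition _ := [Choice of dual by <:].
HB.instance Definition _ := [SubChoice_isSubLmodule of dual by <:].

Lemma dual_linear (f : dual) : linear f.
Proof. by have := dual_funP f; rewrite inE => -[]. Qed.

Lemma dual_continuous (f : dual) : continuous f.
Proof. by have := dual_funP f; rewrite inE => -[]. Qed.

HB.instance Definition _ (f : dual) :=
  GRing.isLinear.Build R V R^o _ (f : V -> R^o) (@dual_linear f).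

Definition dual_norm (f : dual) : R :=
  sup [set `|f x| | x in [set x : V | `|x| <= 1]].

Let dual_bounded (f : dual) : exists M : R, forall x, `|f x| <= M * `|x|.
Proof.
have /linear_boundedP[M [_ Mf]] :=
  @continuous_linear_bounded _ _ _ 0 f (@dual_continuous f 0).
by exists (M + 1); apply: Mf; rewrite ltrDl.
Qed.

Let has_sup_dual_norm (f : dual) :
  has_sup [set `|f x| | x in [set x : V | `|x| <= 1]].
Proof.
split; first by exists `|f 0|; exists 0 => //=; rewrite normr0.
have [M Mf] := dual_bounded f; exists `|M| => _ [x /= x1 <-].
rewrite (le_trans (Mf x))// (le_trans (ler_wpM2r _ (ler_norm M)))//.
by rewrite ler_piMr.
Qed.

Let dual_norm_ub (f : dual) x : `|x| <= 1 -> `|f x| <= dual_norm f.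
Proof.
by move=> x1; apply: (sup_ubound (has_sup_dual_norm f).2); exists x.
Qed.

Let dual_norm_le (f : dual) M : (forall x, `|x| <= 1 -> `|f x| <= M) ->
  dual_norm f <= M.
Proof.
move=> fM; apply: ge_sup; first exact: (has_sup_dual_norm f).1.
by move=> _ [x /= x1 <-]; exact: fM.
Qed.

Fact dual_ler_normD (f g : dual) :
  dual_norm (f + g) <= dual_norm f + dual_norm g.
Proof.
apply: dual_norm_le => x x1; rewrite (le_trans (ler_normD _ _))//.
by rewrite lerD// dual_norm_ub.
Qed.

Fact dual_normrZ (l : R) (f : dual) : dual_norm (l *: f) = `|l| * dual_norm f.
Proof.
have le1 a (g : dual) : dual_norm (a *: g) <= `|a| * dual_norm g.
  apply: dual_norm_le => x x1.
  rewrite (_ : (a *: g) x = a * g x)// normrM.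
  by rewrite ler_wpM2l// dual_norm_ub.
apply/eqP; rewrite eq_le le1/=.
have [->|l0] := eqVneq l 0.
  rewrite normr0 mul0r (le_trans (normr_ge0 ((0 *: f) 0)))//.
  by rewrite dual_norm_ub// normr0.
rewrite -ler_pdivlMl ?normr_gt0// -normfV.
by rewrite -[in leLHS](scale1r f) -(mulVf l0) -scalerA.
Qed.

Fact dual_norm0_eq0 (f : dual) : dual_norm f = 0 -> f = 0.
Proof.
move=> f0; apply/val_inj/funext => x /=.
have [->|x0] := eqVneq x 0; first exact: (linear0 f).
have : `|f (`|x|^-1 *: x)| <= 0.
  rewrite -f0 dual_norm_ub// normrZ normfV normr_id mulVf//.
  by rewrite normr_eq0.
rewrite linearZ/= normr_le0 scaler_eq0 invr_eq0 normr_eq0 (negbTE x0)/=.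
by move/eqP.
Qed.

HB.instance Definition _ := Lmodule_isNormed.Build R dual
  dual_ler_normD dual_normrZ dual_norm0_eq0.

(* The weak* topology on the dual: the topology of pointwise convergence. The
   type [dual] itself carries the topology of the dual norm. *)
Definition weak_star : Type :=
  initial_topology (fun f : dual => (f : V -> R) : {ptws V -> R}).

HB.instance Definition _ := Topological.copy weak_star
  (initial_topology (fun f : dual => (f : V -> R) : {ptws V -> R})).
HB.instance Definition _ := GRing.Lmodule.copy weak_star dual.

Definition weak : Type :=
  initial_topology (fun x : V => (fun f : dual => f x) : {ptws dual -> R}).

HB.instance Definition _ := Topological.copy weak
  (initial_topology (fun x : V => (fun f : dual => f x) : {ptws dual -> R})).

End dual_def.

HB.mixin Record CompleteNormedModule_isHilbert (R : realType) Y
    & CompleteNormedModule R Y := {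
  inner : {dot Y for idfun} ;
  inner_norm : forall y : Y, inner y y = `|y| ^+ 2 }.

#[short(type="hilbertType")]
HB.structure Definition Hilbert (R : realType) :=
  {Y of CompleteNormedModule R Y & CompleteNormedModule_isHilbert R Y}.

Definition weak_star_to_weak_continuous {R : realType} {V W : normedModType R}
    (K : weak_star V -> W) : Prop :=
  continuous (K : weak_star V -> weak W).

(* [is_diff y F (dF y)] forces [dF y] to be the Fréchet derivative of F at y;
   the map dF is then differentiated with respect to the dual norm. *)
Definition twice_differentiable {R : realType} {Y : normedModType R}
    (F : Y -> R^o) : Prop :=
  exists dF : Y -> dual Y, forall y, is_diff y F (dF y) /\ differentiable dF y.

Definition extreme_points {R : realType} {V : lmodType R} (A : set V) : set V :=
  [set u | A u /\ forall v w (t : R), A v -> A w -> 0 < t < 1 ->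
     u = (1 - t) *: v + t *: w -> v = u /\ w = u].

Section metric.
Context {R : realType} {X : Type}.

Definition is_metric (dist : X -> X -> R) : Prop :=
  [/\ forall x y, dist x y = 0 <-> x = y,
      forall x y, dist x y = dist y x
    & forall x y z, dist x z <= dist x y + dist y z].

(* Curves [0,1] -> X are total maps R -> X whose values outside [0,1] are
   ignored. *)
Definition geodesic (dist : X -> X -> R) (g : R -> X) : Prop :=
  forall s t, s \in `[0, 1] -> t \in `[0, 1] ->
    dist (g s) (g t) = `|s - t| * dist (g 0) (g 1).

Definition geodesic_space (dist : X -> X -> R) : Prop :=
  forall x y, exists g, [/\ geodesic dist g, g 0 = x & g 1 = y].

Definition convex_along_geodesics (dist : X -> X -> R) (lambda : R)
    (J : X -> R) : Prop :=
  forall g, geodesic dist g -> forall t, t \in `[0, 1] ->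
    J (g t) <= (1 - t) * J (g 0) + t * J (g 1)
               - lambda / 2 * t * (1 - t) * dist (g 0) (g 1) ^+ 2.

End metric.

Definition metrizes {R : realType} {X : topologicalType} (dist : X -> X -> R) :
    Prop :=
  is_metric dist /\
  forall x, nbhs x = filter_from [set e : R | 0 < e]
                       (fun e => [set y | dist x y < e]).

(* Difference quotients are taken inside [0,1], hence are one-sided at the
   endpoints. *)
Definition weak_derivative {R : realType} {Y : hilbertType R} (f df : R -> Y) :
    Prop :=
  forall y t, t \in `[0, 1] ->
    inner ((s - t)^-1 *: (f s - f t)) y @[s --> within `[0, 1]%classic t^']
      --> inner (df t) y.

Section bochner.
Context {d : measure_display} {T : measurableType d} {R : realType}.
Context {Y : normedModType R} (P : probability T R).

Record simple_fun := SimpleFun {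
  simple_size : nat ;
  simple_set : 'I_simple_size -> set T ;
  simple_val : 'I_simple_size -> Y ;
  simple_measurable : forall i, measurable (simple_set i) }.

Definition simple_eval (s : simple_fun) (x : T) : Y :=
  \sum_(i < simple_size s) \1_(simple_set i) x *: simple_val i.

Definition simple_integral (s : simple_fun) : Y :=
  \sum_(i < simple_size s) fine (P (simple_set i)) *: simple_val i.

Definition is_bochner_integral (f : T -> Y) (v : Y) : Prop :=
  exists s : nat -> simple_fun,
    [/\ {ae P, forall x, simple_eval (s n) x @[n --> \oo] --> f x},
        (\int[P]_x `|f x - simple_eval (s n) x|%:E)%E @[n --> \oo] --> 0%E
      & simple_integral (s n) @[n --> \oo] --> v].

(* Equal to 0 when f is not Bochner integrable. *)
Definition bochner_integral (f : T -> Y) : Y :=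
  xget 0 (is_bochner_integral f).

End bochner.

Section wasserstein.
Context {d : measure_display} {T : measurableType d} {R : realType}.

Definition couplings (mu nu : probability T R) :
    set (probability (T * T)%type R) :=
  [set pi | forall A, measurable A ->
     pushforward pi fst A = mu A /\ pushforward pi snd A = nu A].

(* [fine] sends +oo to 0; this is harmless on a space of finite diameter, where
   all transport costs are finite. *)
Definition wasserstein2 (dist : T -> T -> R) (mu nu : probability T R) : R :=
  Num.sqrt (fine (ereal_inf
    [set (\int[pi]_z (dist z.1 z.2 ^+ 2)%:E)%E | pi in couplings mu nu])).

End wasserstein.

Section lifted_space.
Context {R : realType} {C : normedModType R}.
Context (L : R) (L0 : 0 < L) (B : set (weak_star C)) (B0 : B !=set0).

(* Ω_L with the product of the usual topology on [0,L] and the weak* topology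
   on B. The proofs L0 and B0 only serve to provide a default point, which
   measurable types are required to have. *)
Definition Omega of 0 < L & B !=set0 : Type :=
  (set_type `[0, L]%classic * set_type B)%type.

Local Notation Omega_L := (Omega L0 B0).

HB.instance Definition _ := Topological.on Omega_L.

Definition Omega_point : Omega_L.
Proof.
split; last by have [u Bu] := cid B0; exists u; exact: mem_set.
by exists 0; apply: mem_set; rewrite /= in_itv/= lexx ltW.
Defined.

HB.instance Definition _ := isPointed.Build Omega_L Omega_point.

Definition coef (x : Omega_L) : R := \val x.1.
Definition atom (x : Omega_L) : weak_star C := \val x.2.

Definition dOmega (dB : B -> B -> R) (x y : Omega_L) : R :=
  Num.sqrt (`|coef x - coef y| ^+ 2 + dB x.2 y.2 ^+ 2).

Definition borel_Omega := g_sigma_algebraType (@open Omega_L).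

Definition P2 := probability borel_Omega R.

Definition W2 (dB : B -> B -> R) : P2 -> P2 -> R :=
  @wasserstein2 _ borel_Omega R (dOmega dB).

Definition objective {Y : normedModType R} (K : weak_star C -> Y) (F : Y -> R)
    (nu : P2) : R :=
  F (@bochner_integral _ borel_Omega R Y nu
       (fun x => coef x ^+ 2 *: K (atom x)))
  + \int[nu]_x (coef x ^+ 2).

End lifted_space.

(* Main.v *)
(* No dynamic plans or optimal plans are needed. Write Phi(c,u) = c^2 K u and
   A(nu) = int Phi dnu. If z is t-intermediate between x and y in Omega_L, then
   its coefficient is the affine combination and its atom is t-intermediate in
   B, hence lies on a geodesic of B (concatenate two geodesics); (A8) then bounds
   |Phi(z) - (1-t) Phi(x) - t Phi(y)| by M t(1-t) d(x,y)^2. By compactness the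
   same bound holds for all triples up to a small error and a multiple of the
   excess d(x,z)^2/t + d(z,y)^2/(1-t) - d(x,y)^2 >= 0.

   For a geodesic gamma, nearly optimal plans (gamma_0,gamma_t) and
   (gamma_t,gamma_1) are discretized on a fine finite Borel partition, where
   gluing is multiplication of matrices. The glued matrix has small total excess
   because its endpoint marginal lifts to a coupling of gamma_0 and gamma_1,
   of cost at least W_2^2. Averaging gives
   |A(gamma_t) - (1-t) A(gamma_0) - t A(gamma_1)| <= M t(1-t) W_2^2, and
   likewise for int c^2.

   Finally F is bounded above, near the compact set Phi(Omega_L), hence by
   convexity near every A(nu); being bounded below, it is Lipschitz at the
   points A(nu), and convexity of F concludes. *)
Require Import Defs.
From HB Require Import structures.
From mathcomp Require Import all_boot all_order all_algebra ssrAC.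
From mathcomp Require Import all_classical all_reals all_analysis.
From mathcomp Require Import measurable_realfun sesquilinear ring lra.

Set Implicit Arguments.
Unset Strict Implicit.
Unset Printing Implicit Defensive.

Import Order.TTheory GRing.Theory Num.Theory.
Import numFieldNormedType.Exports.

Local Open Scope classical_set_scope.
Local Open Scope ring_scope.

(** * Hilbert spaces and weak derivatives on the unit interval *)

Section hilbert.
Context {R : realType} {Y : hilbertType R}.
Implicit Types x y z : Y.

(* [inner] with its arguments typed directly in [Y]: the reverse coercions in
   the type of [inner] block rewriting. *)
Definition dotp x y : R := inner x y.

Lemma dotpZl (a : R) x z : dotp (a *: x) z = a * dotp x z.
Proof. exact: linearZl_LR. Qed.

Lemma dotpBl x y z : dotp (x - y) z = dotp x z - dotp y z.
Proof. exact: linearBl. Qed.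

Lemma dotpC x y : dotp x y = dotp y x.
Proof. by rewrite /dotp (hermC inner) expr0 mul1r. Qed.

Lemma dotp_norm x : dotp x x = `|x| ^+ 2.
Proof. exact: inner_norm. Qed.

Lemma dotp0l x : dotp 0 x = 0.
Proof. exact: linear0l. Qed.

Lemma dotp_cauchy_schwarz x y : `|dotp x y| <= `|x| * `|y|.
Proof.
have le1 u v : dotp u v <= `|u| * `|v|.
  have [->|u0] := eqVneq u 0; first by rewrite dotp0l normr0 mul0r.
  have [->|v0] := eqVneq v 0; first by rewrite dotpC dotp0l normr0 mulr0.
  (* Expanding this square gives 2 |u| |v| (|u| |v| - <u, v>) >= 0. *)
  have : 0 <= dotp (`|v| *: u - `|u| *: v) (`|v| *: u - `|u| *: v).
    by rewrite dotp_norm sqr_ge0.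
  rewrite dotpBl !dotpZl (dotpC u) (dotpC v) !dotpBl !dotpZl.
  rewrite !dotp_norm (dotpC v u).
  have : 0 < `|u| * `|v| by rewrite mulr_gt0// normr_gt0.
  nra.
rewrite ler_norml le1 andbT lerNl -(normrN x).
apply: le_trans (le1 _ _).
by rewrite -[- x]scaleN1r dotpZl mulN1r.
Qed.

(** Testing with [y = z] suffices. This turns estimates on weak derivatives, which are tested
    against one vector at a time, into norm estimates. *)
Lemma norm_le_dotp (z : Y) (M : R) : 0 <= M ->
  (forall y, dotp z y <= M * `|y|) -> `|z| <= M.
Proof.
move=> M0 /(_ z); rewrite dotp_norm expr2.
have [->|z0] := eqVneq z 0; first by rewrite normr0.
by rewrite ler_pM2r// normr_gt0.
Qed.

End hilbert.

Section unit_interval_calculus.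
Context {R : realType}.

(* The scalar counterpart of [weak_derivative]. *)
Definition derivative_01 (f df : R -> R) : Prop :=
  forall t : R, t \in `[0, 1] ->
    (s - t)^-1 * (f s - f t) @[s --> within `[0, 1]%classic t^'] --> df t.

Lemma derivative_01_dist (f df : R -> R) : derivative_01 f df ->
  forall t e : R, t \in `[0, 1] -> 0 < e ->
  exists2 d, 0 < d & forall s, s \in `[0, 1] -> s != t -> `|s - t| < d ->
    `|df t - (s - t)^-1 * (f s - f t)| < e.
Proof.
move=> fdf t e t01 e0.
have /cvgrPdist_lt := fdf t t01.
move=> /(_ e e0); rewrite /within/= => /nbhs_ballP[d /= d0 dP].
exists d => // s s01 st sd; apply: (dP s) => //.
by rewrite /ball/= distrC.
Qed.

Lemma derivative_01_is_derive (f df : R -> R) : derivative_01 f df ->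
  forall t : R, t \in `]0, 1[ -> is_derive t 1 f (df t).
Proof.
move=> fdf t; rewrite in_itv/= => /andP[t0 t1].
have t01 : t \in `[0, 1] by rewrite in_itv/= !ltW.
have cv : h^-1 *: ((f \o shift t) (h *: 1) - f t) @[h --> 0^'] --> df t.
  apply/cvgrPdist_lt => e e0.
  have [d d0 dP] := derivative_01_dist fdf t01 e0.
  have m0 : 0 < Num.min d (Num.min t (1 - t)).
    by rewrite !lt_min d0 t0 subr_gt0.
  apply/nbhs_ballP; exists (Num.min d (Num.min t (1 - t))) => //= h.
  rewrite /ball/= sub0r normrN !lt_min => /and3P[hd ht ht1] h0.
  have := dP (h + t); rewrite addrK scaler1; apply => //.
  - rewrite in_itv/=; move: ht ht1; rewrite !ltr_norml => /andP[? ?] /andP[? ?].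
    by apply/andP; split; lra.
  - by rewrite addrC -subr_eq0 addrAC subrr add0r.
split; first by apply/cvg_ex; exists (df t).
exact: cvg_lim cv.
Qed.

Lemma derivative_01_continuous (f df : R -> R) : derivative_01 f df ->
  {within `[0, 1], continuous f}.
Proof.
move=> fdf; apply/subspace_continuousP => t /= t01.
apply/cvgrPdist_lt => e e0.
have [d d0 dP] := derivative_01_dist fdf t01 ltr01.
pose m := e / (`|df t| + 1).
have m0 : 0 < m by rewrite divr_gt0// ltr_wpDl.
rewrite near_withinE; apply/nbhs_ballP.
exists (Num.min d m) => /=; first by rewrite lt_min d0.
move=> s; rewrite /ball/= lt_min distrC => /andP[sd sm] s01.
have [->|st] := eqVneq s t; first by rewrite subrr normr0.
have st0 : s - t != 0 by rewrite subr_eq0.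
have q1 := dP s s01 st sd.
rewrite distrC.
have -> : f s - f t = (s - t) * ((s - t)^-1 * (f s - f t)) by rewrite mulVKf.
rewrite normrM.
have qb : `|(s - t)^-1 * (f s - f t)| <= `|df t| + 1.
  set q := _ * _ in q1 *.
  have := ler_normB (df t) (df t - q); rewrite subKr.
  by move=> /le_trans; apply; rewrite lerD2l ltW.
apply: le_lt_trans (ler_wpM2l _ qb) _ => //.
by rewrite -ltr_pdivlMr// ltr_wpDl.
Qed.

Lemma derivative_01_MVT (f df : R -> R) : derivative_01 f df ->
  forall a b : R, 0 <= a -> a < b -> b <= 1 ->
  exists2 c, a < c < b & f b - f a = df c * (b - a).
Proof.
move=> fdf a b a0 ab b1.
have sub : `[a, b]%classic `<=` `[0, 1]%classic.
  move=> x /=; rewrite !in_itv/= => /andP[ax xb].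
  by rewrite (le_trans a0 ax) (le_trans xb b1).
have [||c cab fc] := @MVT _ f df a b ab.
- move=> x; rewrite in_itv/= => /andP[ax xb].
  apply: (derivative_01_is_derive fdf).
  by rewrite in_itv/= (le_lt_trans a0 ax) (lt_le_trans xb b1).
- exact: continuous_subspaceW sub (derivative_01_continuous fdf).
by exists c => //; rewrite in_itv/= in cab.
Qed.

Lemma derivative_01_lipschitz (f df : R -> R) (M : R) : derivative_01 f df ->
  (forall t : R, t \in `[0, 1] -> `|df t| <= M) ->
  forall a b : R, 0 <= a -> a < b -> b <= 1 -> `|f b - f a| <= M * (b - a).
Proof.
move=> fdf dfM a b a0 ab b1.
have [c /andP[ac cb] ->] := derivative_01_MVT fdf a0 ab b1.
rewrite normrM (@gtr0_norm _ (b - a)) ?subr_gt0// ler_wpM2r ?subr_ge0 ?(ltW ab)//.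
by apply: dfM; rewrite in_itv/=; apply/andP; split; lra.
Qed.

Lemma derivative_01_second_difference (f df ddf : R -> R) (M : R) :
  derivative_01 f df -> derivative_01 df ddf ->
  (forall t : R, t \in `[0, 1] -> `|ddf t| <= M) ->
  forall t : R, 0 < t -> t < 1 ->
  `|f t - (1 - t) * f 0 - t * f 1| <= M * (t * (1 - t)).
Proof.
move=> fdf dfddf ddfM t t0 t1.
(* two mean values [a < t < b], and a third one for [df b - df a] *)
have [a /andP[a0 at_] fa] := derivative_01_MVT fdf (lexx 0) t0 (ltW t1).
have [b /andP[tb b1] fb] := derivative_01_MVT fdf (ltW t0) t1 (lexx 1).
have -> : f t - (1 - t) * f 0 - t * f 1 =
    (t * (1 - t)) * (df a - df b).
  have -> : f 1 = f t + df b * (1 - t) by rewrite -fb; ring.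
  have -> : f t = f 0 + df a * (t - 0) by rewrite -fa; ring.
  ring.
have M0 : 0 <= M.
  by apply: le_trans (ddfM 0 _); rewrite ?normr_ge0// in_itv/= lexx ler01.
rewrite normrM gtr0_norm ?mulr_gt0 ?subr_gt0// mulrC ler_wpM2r//.
  by rewrite mulr_ge0 ?subr_ge0 ?ltW.
rewrite distrC (le_trans (derivative_01_lipschitz dfddf ddfM (ltW a0) _ (ltW b1)))//.
  exact: lt_trans tb.
by rewrite ler_piMr//; lra.
Qed.

End unit_interval_calculus.

Section weak_derivative_estimates.
Context {R : realType} {Y : hilbertType R}.

Lemma weak_derivative_dotp (f df : R -> Y) (y : Y) : weak_derivative f df ->
  derivative_01 (fun t => dotp (f t) y) (fun t => dotp (df t) y).
Proof.
move=> fdf t t01; have := fdf y t t01.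
by under eq_fun do rewrite -/(dotp _ _) dotpZl dotpBl.
Qed.

(** For each fixed [y] the scalar function [dotp (f t) y] has a derivative bounded by [M] times the
    norm of [y]; as [M] does not depend on [y], [norm_le_dotp] concludes. *)
Lemma weak_derivative_lipschitz (f df : R -> Y) (M : R) :
  weak_derivative f df -> (forall t : R, t \in `[0, 1] -> `|df t| <= M) ->
  `|f 1 - f 0| <= M.
Proof.
move=> fdf dfM.
have M0 : 0 <= M.
  by apply: le_trans (dfM 0 _); rewrite ?normr_ge0// in_itv/= lexx ler01.
apply: norm_le_dotp => // y; rewrite dotpBl.
apply: le_trans (ler_norm _) _.
have := derivative_01_lipschitz (weak_derivative_dotp (y := y) fdf) (M := M * `|y|).
move/(_ _ 0 1); rewrite subr0 mulr1; apply => // t t01.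
apply: le_trans (dotp_cauchy_schwarz _ _) _.
by rewrite ler_wpM2r// dfM.
Qed.

Lemma weak_derivative_second_difference (f df ddf : R -> Y) (M : R) :
  weak_derivative f df -> weak_derivative df ddf ->
  (forall t : R, t \in `[0, 1] -> `|ddf t| <= M) ->
  forall t : R, 0 < t -> t < 1 ->
  `|f t - (1 - t) *: f 0 - t *: f 1| <= M * (t * (1 - t)).
Proof.
move=> fdf dfddf ddfM t t0 t1.
have M0 : 0 <= M.
  by apply: le_trans (ddfM 0 _); rewrite ?normr_ge0// in_itv/= lexx ler01.
apply: norm_le_dotp => [|y].
  by rewrite mulr_ge0// mulr_ge0 ?subr_ge0// ltW.
rewrite !dotpBl !dotpZl.
apply: le_trans (ler_norm _) _; rewrite mulrAC.
apply: (derivative_01_second_difference (weak_derivative_dotp (y := y) fdf)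
  (weak_derivative_dotp (y := y) dfddf)) => //.
move=> s s01; apply: le_trans (dotp_cauchy_schwarz _ _) _.
by rewrite ler_wpM2r// ddfM.
Qed.

End weak_derivative_estimates.

(** * Geodesics and second differences *)

(** The gap between the two sides is [((1 - t) * a - t * b) ^+ 2 / (t * (1 - t))], which also
    settles the equality case below. *)
Lemma sqr_add_le {R : realFieldType} (a b t : R) : 0 < t -> t < 1 ->
  (a + b) ^+ 2 <= a ^+ 2 / t + b ^+ 2 / (1 - t).
Proof.
move=> t0 t1; have t'0 : 0 < 1 - t by rewrite subr_gt0.
rewrite -subr_ge0.
have -> : a ^+ 2 / t + b ^+ 2 / (1 - t) - (a + b) ^+ 2 =
    ((1 - t) * a - t * b) ^+ 2 / (t * (1 - t)).
  by field; rewrite ?gt_eqF.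
by rewrite divr_ge0 ?sqr_ge0// ltW// mulr_gt0.
Qed.

Lemma sqr_add_eq {R : realFieldType} (a b t : R) : 0 < t -> t < 1 ->
  a ^+ 2 / t + b ^+ 2 / (1 - t) <= (a + b) ^+ 2 -> (1 - t) * a = t * b.
Proof.
move=> t0 t1; have t'0 : 0 < 1 - t by rewrite subr_gt0.
rewrite -subr_le0.
have -> : a ^+ 2 / t + b ^+ 2 / (1 - t) - (a + b) ^+ 2 =
    ((1 - t) * a - t * b) ^+ 2 / (t * (1 - t)).
  by field; rewrite ?gt_eqF.
rewrite pmulr_lle0 ?invr_gt0 ?mulr_gt0// => sq_le0.
by apply/eqP; rewrite -subr_eq0 -sqrf_eq0 eq_le sq_le0 sqr_ge0.
Qed.

Section metric_facts.
Context {R : realType} {X : Type} {d : X -> X -> R}.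
Hypothesis dm : is_metric d.

Let dC x y : d x y = d y x. Proof. by case: dm. Qed.
Let dD x y z : d x z <= d x y + d y z. Proof. by case: dm. Qed.

Lemma metric_refl x : d x x = 0.
Proof. by case: dm => d0 _ _; apply/d0. Qed.

Lemma metric_ge0 x y : 0 <= d x y.
Proof. by have := dD x y x; rewrite metric_refl (dC y x); lra. Qed.

(** A geodesic from [x] to [z] followed by one from [z] to [y], run at speeds matching the two
    lengths, is Lipschitz with constant [d x y]; its endpoints being at distance exactly [d x y],
    the triangle inequality leaves no slack. *)
Lemma geodesic_through x y z (t : R) : geodesic_space d ->
  0 < t -> t < 1 -> d x z = t * d x y -> d z y = (1 - t) * d x y ->
  exists g, [/\ geodesic d g, g 0 = x, g 1 = y & g t = z].
Proof.
move=> dgeo t0 t1 dxz dzy.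
have [g1 [gg1 g10 g11]] := dgeo x z.
have [g2 [gg2 g20 g21]] := dgeo z y.
pose g r := if r <= t then g1 (r / t) else g2 ((r - t) / (1 - t)).
have t'0 : 0 < 1 - t by rewrite subr_gt0.
have g0 : g 0 = x by rewrite /g ltW// mul0r.
have g1E : g 1 = y by rewrite /g leNgt t1/= divff ?gt_eqF.
have gt : g t = z by rewrite /g lexx divff ?gt_eqF.
have D0 := metric_ge0 x y.
have in1 r : 0 <= r -> r <= t -> r / t \in `[0, 1].
  by move=> r0 rt; rewrite in_itv/= divr_ge0 ?(ltW t0)// ler_pdivrMr// mul1r.
have in2 r : t <= r -> r <= 1 -> (r - t) / (1 - t) \in `[0, 1].
  move=> tr r1; rewrite in_itv/= divr_ge0 ?subr_ge0 ?(ltW t1)//=.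
  by rewrite ler_pdivrMr// mul1r lerD2r.
have le1 r s : 0 <= r -> r <= s -> s <= t -> d (g r) (g s) <= (s - r) * d x y.
  move=> r0 rs st; have rt := le_trans rs st; have s0 := le_trans r0 rs.
  rewrite /g rt st gg1 ?in1// g10 g11 dxz -mulrBl normrM normfV.
  rewrite distrC (ger0_norm (_ : 0 <= s - r)) ?subr_ge0// (gtr0_norm t0).
  by rewrite mulrA divfK ?gt_eqF.
have g2E r : t <= r -> g r = g2 ((r - t) / (1 - t)).
  move=> tr; rewrite /g; case: ifPn => // rt.
  have -> : r = t by apply/eqP; rewrite eq_le rt.
  by rewrite subrr mul0r divff ?gt_eqF// g11 g20.
have le2 r s : t <= r -> r <= s -> s <= 1 -> d (g r) (g s) <= (s - r) * d x y.
  move=> tr rs s1; have ts := le_trans tr rs; have r1 := le_trans rs s1.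
  rewrite !g2E// gg2 ?in2// g20 g21 dzy -mulrBl normrM normfV.
  rewrite [X in `|X|](_ : _ = r - s); last by ring.
  rewrite distrC (ger0_norm (_ : 0 <= s - r)) ?subr_ge0// (gtr0_norm t'0).
  by rewrite mulrA divfK ?gt_eqF.
have le r s : 0 <= r -> r <= s -> s <= 1 -> d (g r) (g s) <= (s - r) * d x y.
  move=> r0 rs s1; have [st|/ltW ts] := leP s t; first exact: le1.
  have [rt|/ltW tr] := leP r t; last exact: le2.
  apply: le_trans (dD _ (g t) _) _.
  have := le1 r t r0 rt (lexx t); have := le2 t s (lexx t) ts s1; lra.
(* The upper bounds on the three pieces cut at [r] and [s] add up to [d x y], and the triangle
   inequality bounds the sum of the three distances below by [d x y]; so each bound is attained. *)
have eq r s : 0 <= r -> r <= s -> s <= 1 -> d (g r) (g s) = (s - r) * d x y.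
  move=> r0 rs s1; apply/eqP; rewrite eq_le le//=.
  have := le 0 r (lexx 0) r0 (le_trans rs s1).
  have := le s 1 (le_trans r0 rs) s1 (lexx 1).
  rewrite g0 g1E.
  have := dD x (g r) y; have := dD (g r) (g s) y; lra.
exists g; split => // r s; rewrite !in_itv/= => /andP[r0 r1] /andP[s0 s1].
rewrite g0 g1E; have [rs|/ltW sr] := leP r s.
  by rewrite distrC ger0_norm ?subr_ge0// eq.
by rewrite ger0_norm ?subr_ge0// dC eq.
Qed.

(** The defect in a weighted form of the triangle inequality. It is linear in squared distances, so
    its average under a plan is a combination of transport costs; for [0 < t < 1] it vanishes
    exactly when [z] is [t]-intermediate between [x] and [y]. *)
Definition excess (t : R) x z y : R :=
  d x z ^+ 2 / t + d z y ^+ 2 / (1 - t) - d x y ^+ 2.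

Lemma excess_ge0 (t : R) x z y : 0 < t -> t < 1 -> 0 <= excess t x z y.
Proof.
move=> t0 t1; rewrite subr_ge0; apply: le_trans (sqr_add_le _ _ t0 t1).
by rewrite ler_sqr ?nnegrE ?metric_ge0 ?addr_ge0 ?metric_ge0.
Qed.

(** The triangle inequality and [sqr_add_le] must both be equalities: the first makes the two
    lengths add up, the second fixes their ratio. *)
Lemma excess_le0 (t : R) x z y : 0 < t -> t < 1 -> excess t x z y <= 0 ->
  d x z = t * d x y /\ d z y = (1 - t) * d x y.
Proof.
move=> t0 t1; rewrite subr_le0 => e0.
have tri : d x y ^+ 2 <= (d x z + d z y) ^+ 2.
  by rewrite ler_sqr ?nnegrE ?metric_ge0 ?addr_ge0 ?metric_ge0.
have eq1 := sqr_add_eq t0 t1 (le_trans e0 tri).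
have eq2 : d x y = d x z + d z y.
  apply/eqP; rewrite -(@eqrXn2 _ 2) ?addr_ge0 ?metric_ge0//.
  by rewrite eq_le tri (le_trans (sqr_add_le _ _ t0 t1)).
by split; rewrite eq2; lra.
Qed.

End metric_facts.

Section geodesic_estimates.
Context {R : realType} {X : Type} {Y : hilbertType R} {d : X -> X -> R}.
Context {k : X -> Y} {c : R}.
Hypothesis dm : is_metric d.
Hypothesis dgeo : geodesic_space d.
Hypothesis kd : forall u : R -> X, geodesic d u ->
  exists2 v1 : R -> Y, weak_derivative (fun t => k (u t)) v1 &
  exists2 v2 : R -> Y, weak_derivative v1 v2 &
  forall t : R, t \in `[0, 1] ->
    `|v1 t| <= c * d (u 0) (u 1) /\ `|v2 t| <= c * d (u 0) (u 1) ^+ 2.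

Lemma weak_derivative_along_geodesics_lipschitz x y :
  `|k x - k y| <= c * d x y.
Proof.
have [g [/kd[v1 gv1 [v2 _ vb]] g0 g1]] := dgeo x y.
rewrite distrC -g0 -g1.
by apply: (weak_derivative_lipschitz gv1) => t /vb[].
Qed.

Lemma weak_derivative_along_geodesics_second_difference x y z (t : R) :
  0 < t -> t < 1 -> d x z = t * d x y -> d z y = (1 - t) * d x y ->
  `|k z - (1 - t) *: k x - t *: k y| <= c * d x y ^+ 2 * (t * (1 - t)).
Proof.
move=> t0 t1 xz zy.
have [g [/kd[v1 gv1 [v2 v12 vb]] g0 g1 <-]] := geodesic_through dm dgeo t0 t1 xz zy.
rewrite -g0 -g1.
by apply: (weak_derivative_second_difference gv1 v12) => // s /vb[].
Qed.

End geodesic_estimates.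

Section scaled_second_difference.
Context {R : realType} {V : normedModType R}.

Lemma scaled_second_difference (a b t M A D L c : R) (u v w : V) :
  0 < t -> t < 1 -> 0 <= a -> a <= L -> 0 <= b -> b <= L -> 0 <= c -> 0 <= D ->
  `|w| <= M -> `|w - u| <= c * (t * D) -> `|w - v| <= c * ((1 - t) * D) ->
  `|w - (1 - t) *: u - t *: v| <= c * D ^+ 2 * (t * (1 - t)) ->
  `|((1 - t) * a + t * b) ^+ 2 *: w - (1 - t) *: (a ^+ 2 *: u)
      - t *: (b ^+ 2 *: v)|
  <= (M + 2 * L * c + L ^+ 2 * c) * (t * (1 - t)) * ((a - b) ^+ 2 + D ^+ 2).
Proof.
move=> t0 t1 a0 aL b0 bL c0 D0 wM wu wv wuv.
set m := (1 - t) * a + t * b.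
have t'0 : 0 < 1 - t by rewrite subr_gt0.
have m0 : 0 <= m by rewrite addr_ge0// mulr_ge0// ltW.
have mL : m <= L by rewrite /m; nra.
have L0 : 0 <= L by exact: le_trans mL.
(* Product rule for second differences: that of the squared coefficients times [w], that of the
   vectors times [m ^+ 2], and two mixed products of first-order increments. *)
have -> : m ^+ 2 *: w - (1 - t) *: (a ^+ 2 *: u) - t *: (b ^+ 2 *: v) =
    - (t * (1 - t) * (a - b) ^+ 2) *: w
    + m ^+ 2 *: (w - (1 - t) *: u - t *: v)
    + ((1 - t) * (a ^+ 2 - m ^+ 2)) *: (w - u)
    + (t * (b ^+ 2 - m ^+ 2)) *: (w - v).
  rewrite !scalerBr !scalerA.
  rewrite [RHS](AC (1*3*2*2) ((1*2*5*7)*(3*6)*(4*8))) /= -!opprD -!scalerDl.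
  by congr (_ *: w - _ *: u - _ *: v); rewrite /m; ring.
apply: le_trans (ler_normD _ _) _.
apply: le_trans (lerD (ler_normD _ _) (lexx _)) _.
apply: le_trans (lerD (lerD (ler_normD _ _) (lexx _)) (lexx _)) _.
rewrite (normrZ _ w) (normrZ _ (w - u)) (normrZ _ (w - v)) (normrZ (m ^+ 2)).
have K0 : 0 <= t * (1 - t) by rewrite mulr_ge0 ?(ltW t0) ?(ltW t'0).
have n1 : `|- (t * (1 - t) * (a - b) ^+ 2)| = t * (1 - t) * (a - b) ^+ 2.
  by rewrite normrN ger0_norm// mulr_ge0 ?sqr_ge0.
have n2 : `|m ^+ 2| = m ^+ 2 by rewrite ger0_norm// sqr_ge0.
have n3 : `|(1 - t) * (a ^+ 2 - m ^+ 2)| <= (1 - t) * (t * `|a - b| * (2 * L)).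
  have -> : (1 - t) * (a ^+ 2 - m ^+ 2) = (1 - t) * (t * (a - b) * (a + m)).
    by rewrite /m; ring.
  rewrite !normrM (gtr0_norm t'0) (gtr0_norm t0) ler_wpM2l ?(ltW t'0)//.
  rewrite ler_wpM2l ?mulr_ge0 ?(ltW t0)// ger0_norm ?(addr_ge0 a0 m0)//.
  by rewrite mulr_natl mulr2n lerD.
have n4 : `|t * (b ^+ 2 - m ^+ 2)| <= t * ((1 - t) * `|a - b| * (2 * L)).
  have -> : t * (b ^+ 2 - m ^+ 2) = t * ((1 - t) * (b - a) * (b + m)).
    by rewrite /m; ring.
  rewrite !normrM (gtr0_norm t'0) (gtr0_norm t0) distrC ler_wpM2l ?(ltW t0)//.
  rewrite ler_wpM2l ?mulr_ge0 ?(ltW t'0)// ger0_norm ?(addr_ge0 b0 m0)//.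
  by rewrite mulr_natl mulr2n lerD.
rewrite n1 n2.
have m2 : m ^+ 2 <= L ^+ 2 by rewrite ler_sqr ?nnegrE.
have p1 : t * (1 - t) * (a - b) ^+ 2 * `|w| <= t * (1 - t) * (a - b) ^+ 2 * M.
  by rewrite ler_wpM2l// mulr_ge0 ?sqr_ge0.
have p2 := ler_pM (sqr_ge0 m) (normr_ge0 _) m2 wuv.
have p3 := ler_pM (normr_ge0 _) (normr_ge0 _) n3 wu.
have p4 := ler_pM (normr_ge0 _) (normr_ge0 _) n4 wv.
apply: le_trans (lerD (lerD (lerD p1 p2) p3) p4) _.
rewrite -[(a - b) ^+ 2](real_normK (num_real _)).
set q := `|a - b|.
have M0 : 0 <= M by exact: le_trans wM.
(* The two mixed terms add up to [2 * L * c * t * (1 - t) * q * D], and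
   [q * D <= q ^+ 2 + D ^+ 2]. *)
rewrite -subr_ge0.
rewrite [leRHS](_ : _ = (t * (1 - t)) * (M * D ^+ 2 + L ^+ 2 * c * q ^+ 2
  + (2 * L * c) * (q ^+ 2 + D ^+ 2 - q * D))); last by ring.
have q1 : 0 <= M * D ^+ 2 by rewrite mulr_ge0 ?sqr_ge0.
have q2 : 0 <= L ^+ 2 * c * q ^+ 2.
  by rewrite mulr_ge0 ?sqr_ge0// mulr_ge0 ?sqr_ge0.
have q3 : 0 <= (2 * L * c) * (q ^+ 2 + D ^+ 2 - q * D).
  rewrite mulr_ge0 ?mulr_ge0//; nra.
by rewrite mulr_ge0// addr_ge0// addr_ge0.
Qed.

End scaled_second_difference.

(** * Finite partitions and couplings given by matrices *)

Lemma integral_cst_probability {dsp : measure_display}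
    {T : measurableType dsp} {R : realType} (P : probability T R) (r : R) :
  (\int[P]_x r%:E = r%:E)%E.
Proof.
have := @integral_cst _ _ _ P setT measurableT r%:E.
by rewrite [X in (_ * X)%E]probability_setT mule1.
Qed.

Section step_functions.
Context {dsp : measure_display} {T : measurableType dsp} {R : realType}.
Context {I : finType} {q : T -> I}.
Hypothesis mq : forall i, measurable (q @^-1` [set i]).

Lemma step_indicE (h : I -> R) x :
  h (q x) = \sum_(i : I) h i * \1_(q @^-1` [set i]) x.
Proof.
rewrite (bigD1 (q x))//= big1 ?addr0 => [|i iq].
  by rewrite indicE mem_set ?mulr1.
by rewrite indicE memNset ?mulr0//= => /eqP; rewrite eq_sym (negbTE iq).
Qed.

Lemma measurable_step (h : I -> R) : measurable_fun [set: T] (h \o q).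
Proof.
rewrite (_ : h \o q =
    fun x => \sum_(i <- index_enum I) h i * \1_(q @^-1` [set i]) x).
  by apply: measurable_sum => i; apply: measurable_funM.
by apply/funext => x; exact: step_indicE.
Qed.

(** A finite measurable partition is encoded by its index map [q]; the cells are the fibres, some of
    which may be empty or null. *)
Definition cell_mass (P : probability T R) (i : I) : R :=
  fine (P (q @^-1` [set i])).

Lemma cell_mass_ge0 P i : 0 <= cell_mass P i.
Proof. by rewrite fine_ge0. Qed.

Lemma integral_step (P : probability T R) (h : I -> R) (A : set T) :
  measurable A -> (forall i, 0 <= h i) ->
  (\int[P]_(x in A) (h (q x))%:E)%E =
  (\sum_(i : I) h i * fine (P (q @^-1` [set i] `&` A)))%:E.
Proof.
move=> mA h0.
under eq_integral do rewrite step_indicE -sumEFin.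
rewrite (ge0_integral_sum _ _ (f := fun i x => (h i * \1_(q @^-1` [set i]) x)%:E))//.
- rewrite -sumEFin; apply: eq_bigr => i _.
  rewrite (integralZl_indic _ (fun=> q @^-1` [set i]))//; last first.
    by rewrite ltNge h0.
  rewrite integral_indic// EFinM fineK// fin_num_measure//.
  exact: measurableI.
- move=> i; apply/measurable_EFinP/(measurable_funS measurableT) => //.
  by apply: measurable_funM.
- by move=> i x _; rewrite lee_fin mulr_ge0.
Qed.

Lemma cell_decomposition (P : probability T R) (A : set T) : measurable A ->
  P A = (\sum_(i : I) fine (P (q @^-1` [set i] `&` A)))%:E.
Proof.
move=> mA; rewrite -[LHS]mul1e -(@integral_cst _ _ _ P A)//.
rewrite (integral_step P mA (h := fun=> 1))//.
by under eq_bigr do rewrite mul1r.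
Qed.

Lemma cell_mass_sum (P : probability T R) : \sum_(i : I) cell_mass P i = 1.
Proof.
apply: EFin_inj; rewrite -(probability_setT P) cell_decomposition//.
by congr (_%:E); apply: eq_bigr => i _; rewrite setIT.
Qed.

End step_functions.

Section matrix_coupling.
Context {dsp : measure_display} {T : measurableType dsp} {R : realType}.
Context {I : finType} {q : T -> I}.
Hypothesis mq : forall i, measurable (q @^-1` [set i]).

Definition cell_pair (z : T * T) : I * I := (q z.1, q z.2).

Lemma preimage_cell_pair (i j : I) :
  cell_pair @^-1` [set (i, j)] = (q @^-1` [set i]) `*` (q @^-1` [set j]).
Proof. by apply/seteqP; split => -[x y] /= [<- <-]. Qed.

Lemma measurable_cell_pair k : measurable (cell_pair @^-1` [set k]).
Proof. by case: k => i j; rewrite preimage_cell_pair; exact: measurableX. Qed.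

Variables (mu nu : probability T R) (r : I -> I -> R).
Hypothesis r0 : forall i j, 0 <= r i j.
Hypothesis r_row : forall i, \sum_j r i j = cell_mass (q := q) mu i.
Hypothesis r_col : forall j, \sum_i r i j = cell_mass (q := q) nu j.

(* Density of the coupling with respect to the product measure; the entries
   with a null cell vanish since then [r i j = 0] (and 0^-1 = 0). *)
Let w (k : I * I) : R :=
  r k.1 k.2 / (cell_mass (q := q) mu k.1 * cell_mass (q := q) nu k.2).

Let w0 k : 0 <= w k.
Proof. by rewrite divr_ge0// mulr_ge0// cell_mass_ge0. Qed.

Definition matrix_measure (A : set (T * T)) : \bar R :=
  (\int[(mu \x nu)]_(z in A) (w (cell_pair z))%:E)%E.

Let matrix_measure0 : matrix_measure set0 = 0%E.
Proof. by rewrite /matrix_measure integral_set0. Qed.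

Let matrix_measure_ge0 A : (0 <= matrix_measure A)%E.
Proof. by apply: integral_ge0 => z _; rewrite lee_fin w0. Qed.

Let matrix_measure_semi_sigma_additive : semi_sigma_additive matrix_measure.
Proof.
apply: (@semi_sigma_additive_nng_induced _ _ R (mu \x nu)%E
  (fun z => (w (cell_pair z))%:E)).
  apply/measurable_EFinP.
  exact: (measurable_step (q := cell_pair) measurable_cell_pair).
by move=> z; rewrite lee_fin w0.
Qed.

HB.instance Definition _ := isMeasure.Build _ _ _ matrix_measure
  matrix_measure0 matrix_measure_ge0 matrix_measure_semi_sigma_additive.

Let r_le_row i j : r i j <= cell_mass (q := q) mu i.
Proof. by rewrite -r_row (bigD1 j)//= lerDl sumr_ge0. Qed.

Let r_le_col i j : r i j <= cell_mass (q := q) nu j.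
Proof. by rewrite -r_col (bigD1 i)//= lerDl sumr_ge0. Qed.

Let r_null_row i j : cell_mass (q := q) mu i = 0 -> r i j = 0.
Proof. by move=> m0; apply/eqP; rewrite eq_le r0 -{1}m0 r_le_row. Qed.

Let r_null_col i j : cell_mass (q := q) nu j = 0 -> r i j = 0.
Proof. by move=> m0; apply/eqP; rewrite eq_le r0 -{1}m0 r_le_col. Qed.

Lemma matrix_measureX (A B : set T) : measurable A -> measurable B ->
  matrix_measure (A `*` B) = (\sum_(k : I * I) w k *
    (fine (mu (q @^-1` [set k.1] `&` A)) *
     fine (nu (q @^-1` [set k.2] `&` B))))%:E.
Proof.
move=> mA mB.
rewrite /matrix_measure.
rewrite (integral_step (q := cell_pair) measurable_cell_pair (mu \x nu)%E)//;
  last exact: measurableX.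
congr (_%:E); apply: eq_bigr => -[i j] _; congr (_ * _).
have mqI k C : measurable C -> measurable (q @^-1` [set k] `&` C).
  exact: measurableI.
rewrite preimage_cell_pair -setXI/=.
have mA' := mqI i A mA; have mB' := mqI j B mB.
rewrite -fineM; try exact: fin_num_measure.
by congr fine; exact: product_measure1E.
Qed.

Lemma matrix_measure_fst (A : set T) : measurable A ->
  matrix_measure (A `*` setT) = mu A.
Proof.
move=> mA; rewrite matrix_measureX// (cell_decomposition mq mu mA).
congr (_%:E).
rewrite -(pair_bigA _ (fun i j => w (i, j) * (fine (mu (q @^-1` [set i] `&` A))
  * fine (nu (q @^-1` [set j] `&` setT)))))/=.
apply: eq_bigr => i _.
under eq_bigr do rewrite setIT -/(cell_mass (q := q) nu _) /w/=.
(* On a null cell both sides vanish; otherwise the row sum of [r] cancels the mass of the cell in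
   the denominator. *)
have [m0|m0] := eqVneq (cell_mass (q := q) mu i) 0.
  have -> : fine (mu (q @^-1` [set i] `&` A)) = 0.
    apply/eqP; rewrite eq_le fine_ge0// andbT -m0 fine_le ?fin_num_measure//.
    - exact: measurableI.
    - by rewrite le_measure ?inE//; exact: measurableI.
  by apply: big1 => j _; rewrite mul0r mulr0.
rewrite -[RHS]mulr1 -(divff m0) -[X in _ = _ * (X / _)]r_row mulr_suml mulr_sumr.
apply: eq_bigr => j _.
have [n0|n0] := eqVneq (cell_mass (q := q) nu j) 0.
  by rewrite r_null_col// !mul0r mulr0.
by field; rewrite m0.
Qed.

Lemma matrix_measure_snd (B : set T) : measurable B ->
  matrix_measure (setT `*` B) = nu B.
Proof.
move=> mB; rewrite matrix_measureX// (cell_decomposition mq nu mB).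
congr (_%:E).
rewrite -(pair_bigA _ (fun i j => w (i, j) * (fine (mu (q @^-1` [set i] `&` setT))
  * fine (nu (q @^-1` [set j] `&` B)))))/= exchange_big/=.
apply: eq_bigr => j _.
under eq_bigr do rewrite setIT -/(cell_mass (q := q) mu _) /w/=.
have [m0|m0] := eqVneq (cell_mass (q := q) nu j) 0.
  have -> : fine (nu (q @^-1` [set j] `&` B)) = 0.
    apply/eqP; rewrite eq_le fine_ge0// andbT -m0 fine_le ?fin_num_measure//.
    - exact: measurableI.
    - by rewrite le_measure ?inE//; exact: measurableI.
  by apply: big1 => i _; rewrite !mulr0.
rewrite -[RHS]mulr1 -(divff m0) -[X in _ = _ * (X / _)]r_col mulr_suml mulr_sumr.
apply: eq_bigr => i _.
have [n0|n0] := eqVneq (cell_mass (q := q) mu i) 0.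
  by rewrite r_null_row// !mul0r mulr0.
by field; rewrite m0.
Qed.

Let matrix_measure_setT : matrix_measure setT = 1%E.
Proof. by rewrite -setXTT matrix_measure_fst// probability_setT. Qed.

HB.instance Definition _ := Measure_isProbability.Build _ _ _ matrix_measure
  matrix_measure_setT.

(** On the product of cells [i] and [j] the coupling is [r i j] times the product of the normalized
    restrictions of [mu] and [nu]. This leads back from matrices to genuine couplings, with which
    [wasserstein2] can be compared. *)
Lemma matrix_coupling : exists2 pi : probability (T * T)%type R,
  couplings mu nu pi &
  forall i j, cell_mass (q := cell_pair) pi (i, j) = r i j.
Proof.
exists matrix_measure.
  move=> A mA; split; rewrite /pushforward.
    rewrite (_ : fst @^-1` A = A `*` setT); first exact: matrix_measure_fst.
    by apply/seteqP; split => -[x y] //= [].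
  rewrite (_ : snd @^-1` A = setT `*` A); first exact: matrix_measure_snd.
  by apply/seteqP; split => -[x y] //= [].
move=> i j; rewrite /cell_mass preimage_cell_pair.
etransitivity; first exact: (congr1 fine (matrix_measureX (mq i) (mq j))).
rewrite /=.
rewrite (bigD1 (i, j))//= big1 => [|[i' j'] ij].
  rewrite !setIid addr0 /w/= -/(cell_mass (q := q) mu i).
  rewrite -/(cell_mass (q := q) nu j).
  have [m0|m0] := eqVneq (cell_mass (q := q) mu i) 0.
    by rewrite r_null_row// !mul0r.
  have [n0|n0] := eqVneq (cell_mass (q := q) nu j) 0.
    by rewrite r_null_col// !mul0r.
  by rewrite divfK// mulf_neq0.
have [ii|ii] := eqVneq i' i.
  rewrite [X in fine (nu X)](_ : _ = set0) ?measure0 ?mulr0//.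
  apply/seteqP; split => x //= [qj' qj].
  by move: ij; rewrite ii -qj' -qj eqxx.
rewrite [X in fine (mu X)](_ : _ = set0) ?measure0 ?mul0r ?mulr0//.
by apply/seteqP; split => x //= [qi' qi]; move: ii; rewrite -qi' -qi eqxx.
Qed.

End matrix_coupling.

(** * Quantized transport costs and gluing *)

Lemma measurable_fun_uniform_limit {dsp : measure_display}
  {T : measurableType dsp} {R : realType} (f : T -> R) :
  (forall e, 0 < e -> exists2 g : T -> R, measurable_fun [set: T] g &
    forall x, `|g x - f x| <= e) -> measurable_fun [set: T] f.
Proof.
move=> fapprox.
have /choice[g gP] : forall n, exists g : T -> R,
    measurable_fun [set: T] g /\ forall x, `|g x - f x| <= n.+1%:R^-1.
  by move=> n; have [|g mg gf] := fapprox n.+1%:R^-1; [rewrite invr_gt0|exists g].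
apply: (@measurable_fun_cvg _ _ _ _ g) => [n|x _]; first by have [] := gP n.
apply/cvgrPdist_lt => e e0; near=> n.
rewrite distrC; apply: le_lt_trans ((gP n).2 x) _.
by near: n; exact: (near_infty_natSinv_lt (PosNum e0)).
Unshelve. all: by end_near. Qed.

Section transport.
Context {dsp : measure_display} {T : measurableType dsp} {R : realType}.
Context {d : T -> T -> R} {D : R}.
Hypothesis dm : is_metric d.
Hypothesis dD : forall x y, d x y <= D.

(** [y \o q] rounds every point to one of finitely many representatives. Those of empty cells are
    arbitrary, and [y i] may lie outside its own cell. *)
Definition quantizer (I : finType) (q : T -> I) (y : I -> T) (e : R) : Prop :=
  (forall i, measurable (q @^-1` [set i])) /\ forall x, d (y (q x)) x <= e.

(** Total boundedness, in a form that provides measurable cells. *)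
Definition quantizable : Prop := forall e : R, 0 < e ->
  exists n (q : T -> 'I_n) (y : 'I_n -> T), quantizer q y e.

Hypothesis dq : quantizable.

Let d0 x y : 0 <= d x y. Proof. exact: metric_ge0. Qed.
Let dC x y : d x y = d y x. Proof. by case: dm. Qed.
Let dtri x y z : d x z <= d x y + d y z. Proof. by case: dm. Qed.

Lemma quantizer_dist (I : finType) (q : T -> I) (y : I -> T) (e : R) x x' :
  quantizer q y e -> `|d (y (q x)) (y (q x')) - d x x'| <= 2 * e.
Proof.
move=> [_ ye]; rewrite ler_norml; apply/andP; split.
- have := dtri x (y (q x)) x'; have := dtri (y (q x)) (y (q x')) x'.
  have := ye x; have := ye x'; rewrite (dC x (y (q x))); lra.
- have := dtri (y (q x)) x (y (q x')); have := dtri x x' (y (q x')).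
  have := ye x; have := ye x'; rewrite (dC x' (y (q x'))); lra.
Qed.

Lemma quantizer_sqr_dist (I : finType) (q : T -> I) (y : I -> T) (e : R) x x' :
  quantizer q y e ->
  `|d (y (q x)) (y (q x')) ^+ 2 - d x x' ^+ 2| <= 4 * D * e.
Proof.
move=> qe; rewrite subr_sqr normrM (_ : 4 * D * e = (2 * e) * (2 * D)); last by ring.
apply: ler_pM => //; first exact: quantizer_dist qe.
rewrite ger0_norm ?addr_ge0//.
by have := dD (y (q x)) (y (q x')); have := dD x x'; lra.
Qed.

(** The approximants are constant on products of cells, so measurability holds for the product
    sigma-algebra, on which couplings live. *)
Lemma measurable_dist : measurable_fun [set: T * T] (fun z => d z.1 z.2).
Proof.
apply: measurable_fun_uniform_limit => e e0.
have [|n [q [y qy]]] := dq (e := e / 2); first by rewrite divr_gt0.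
exists (fun z => d (y (q z.1)) (y (q z.2))); last first.
  by move=> z; have := quantizer_dist z.1 z.2 qy; rewrite mulrC divfK.
exact: (measurable_step (measurable_cell_pair qy.1)
  (fun k : 'I_n * 'I_n => d (y k.1) (y k.2))).
Qed.

Definition transport_cost (pi : probability (T * T)%type R) : \bar R :=
  (\int[pi]_z (d z.1 z.2 ^+ 2)%:E)%E.

Lemma transport_cost_ge0 (pi : probability (T * T)%type R) :
  (0 <= transport_cost pi)%E.
Proof. by apply: integral_ge0 => z _; rewrite lee_fin sqr_ge0. Qed.

Definition cell_pair_sum (I : finType) (q : T -> I) (h : I -> I -> R)
    (pi : probability (T * T)%type R) :=
  \sum_i \sum_j h i j * cell_mass (q := cell_pair (q := q)) pi (i, j).

Lemma integral_cell_pair (I : finType) (q : T -> I) (h : I -> I -> R)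
    (pi : probability (T * T)%type R) :
  (forall i, measurable (q @^-1` [set i])) -> (forall i j, 0 <= h i j) ->
  (\int[pi]_z (h (q z.1) (q z.2))%:E)%E = (cell_pair_sum q h pi)%:E.
Proof.
move=> mq h0.
have := @integral_step _ _ _ _ _ (measurable_cell_pair mq) pi
  (fun k => h k.1 k.2) setT measurableT (fun k => h0 _ _).
move=> ->; congr (_%:E); rewrite /cell_pair_sum pair_big/=.
by apply: eq_bigr => -[i j] _; rewrite setIT.
Qed.

Let measurable_sqr_dist :
  measurable_fun [set: T * T] (fun z => (d z.1 z.2 ^+ 2)%:E).
Proof.
apply/measurable_EFinP; apply: (@measurable_funX _ _ _ _ (fun z => d z.1 z.2)).
exact: measurable_dist.
Qed.

Let measurable_cell_sqr_dist (I : finType) (q : T -> I) (y : I -> T) :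
  (forall i, measurable (q @^-1` [set i])) ->
  measurable_fun [set: T * T]
    (fun z => (d (y (q z.1)) (y (q z.2)) ^+ 2)%:E).
Proof.
move=> mq; apply/measurable_EFinP.
exact: (measurable_step (measurable_cell_pair mq)
  (fun k : I * I => d (y k.1) (y k.2) ^+ 2)).
Qed.

(** The pointwise error of [quantizer_sqr_dist] is integrated. Both inequalities are additive
    because the cost is an extended real, whose finiteness is only a consequence of the first
    one. *)
Lemma transport_cost_quantized (I : finType) (q : T -> I) (y : I -> T) (e : R)
    (pi : probability (T * T)%type R) : quantizer q y e ->
  let s := cell_pair_sum q (fun i j => d (y i) (y j) ^+ 2) pi in
  (transport_cost pi <= (s + 4 * D * e)%:E)%E /\
  (s%:E <= transport_cost pi + (4 * D * e)%:E)%E.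
Proof.
move=> qe s; have [mq ye] := qe.
have ptT : T by exact: point.
have e0 : 0 <= e by exact: le_trans (d0 _ _) (ye ptT).
have D0 : 0 <= D by exact: le_trans (d0 ptT ptT) (dD _ _).
have De0 : 0 <= 4 * D * e by rewrite !mulr_ge0.
have sE : (\int[pi]_z (d (y (q z.1)) (y (q z.2)) ^+ 2)%:E)%E = s%:E.
  apply: (integral_cell_pair (h := fun i j => d (y i) (y j) ^+ 2)) => // i j.
  exact: sqr_ge0.
have cE := integral_cst_probability pi (4 * D * e).
have ge0c (z : T * T) : (0 <= (4 * D * e)%:E)%E by rewrite lee_fin.
have ge0s (z : T * T) : (0 <= (d (y (q z.1)) (y (q z.2)) ^+ 2)%:E)%E.
  by rewrite lee_fin sqr_ge0.
have ge0d (z : T * T) : (0 <= (d z.1 z.2 ^+ 2)%:E)%E by rewrite lee_fin sqr_ge0.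
have ms := measurable_cell_sqr_dist y mq.
split.
  rewrite EFinD -sE -cE -ge0_integralD//.
  apply: ge0_le_integral => //; first exact: emeasurable_funD.
  move=> z _; rewrite -EFinD lee_fin.
  by have := quantizer_sqr_dist z.1 z.2 qe; rewrite ler_distl lerBlDr => /andP[].
rewrite -sE -cE -ge0_integralD//.
apply: ge0_le_integral => //; first exact: emeasurable_funD.
move=> z _; rewrite -EFinD lee_fin.
by have := quantizer_sqr_dist z.1 z.2 qe; rewrite ler_distl => /andP[].
Qed.

Lemma cell_pair_mass_row (I : finType) (q : T -> I) (mu nu : probability T R)
    (pi : probability (T * T)%type R) i :
  (forall i, measurable (q @^-1` [set i])) -> couplings mu nu pi ->
  \sum_j cell_mass (q := cell_pair (q := q)) pi (i, j) = cell_mass (q := q) mu i.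
Proof.
move=> mq pic; apply: EFin_inj.
rewrite /cell_mass [in RHS]fineK ?fin_num_measure//.
have [<- _] := pic _ (mq i); rewrite /pushforward.
rewrite (cell_decomposition (q := fun z : T * T => q z.2) _ pi); first last.
- rewrite (_ : _ @^-1` _ = (q @^-1` [set i]) `*` setT); first exact: measurableX.
  by apply/seteqP; split => -[a b] //= [].
- move=> j; rewrite (_ : _ @^-1` _ = setT `*` (q @^-1` [set j])).
    exact: measurableX.
  by apply/seteqP; split => -[a b] //= [].
congr (_%:E); apply: eq_bigr => j _; congr (fine (pi _)).
by apply/seteqP; split => -[a b] /= [<- <-].
Qed.

Lemma cell_pair_mass_col (I : finType) (q : T -> I) (mu nu : probability T R)
    (pi : probability (T * T)%type R) j :
  (forall i, measurable (q @^-1` [set i])) -> couplings mu nu pi ->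
  \sum_i cell_mass (q := cell_pair (q := q)) pi (i, j) = cell_mass (q := q) nu j.
Proof.
move=> mq pic; apply: EFin_inj.
rewrite /cell_mass [in RHS]fineK ?fin_num_measure//.
have [_ <-] := pic _ (mq j); rewrite /pushforward.
rewrite (cell_decomposition (q := fun z : T * T => q z.1) _ pi); first last.
- rewrite (_ : _ @^-1` _ = setT `*` (q @^-1` [set j])); first exact: measurableX.
  by apply/seteqP; split => -[a b] //= [].
- move=> i; rewrite (_ : _ @^-1` _ = (q @^-1` [set i]) `*` setT).
    exact: measurableX.
  by apply/seteqP; split => -[a b] //= [].
congr (_%:E); apply: eq_bigr => i _; congr (fine (pi _)).
by apply/seteqP; split => -[a b] /= [<- <-].
Qed.

End transport.

Lemma big_triple {V : nmodType} {I : finType} (f : I * I * I -> V) :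
  \sum_k f k = \sum_i \sum_j \sum_l f (i, j, l).
Proof.
rewrite (pair_bigA _ (fun i j => \sum_l f (i, j, l)))/=.
rewrite (pair_bigA _ (fun k l => f (k.1, k.2, l)))/=.
by apply: eq_bigr => -[[]].
Qed.

Section wasserstein_gluing.
Context {dsp : measure_display} {T : measurableType dsp} {R : realType}.
Context {d : T -> T -> R} {D : R}.
Hypothesis dm : is_metric d.
Hypothesis dD : forall x y, d x y <= D.
Hypothesis dq : quantizable (d := d).

Local Notation W := (wasserstein2 d).

Lemma wasserstein2_sqr_le (mu nu : probability T R) pi : couplings mu nu pi ->
  ((W mu nu ^+ 2)%:E <= transport_cost (d := d) pi)%E.
Proof.
move=> pic; rewrite /wasserstein2; set S := [set _ | _ in _].
have S0 : (0 <= ereal_inf S)%E.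
  by apply: le_ereal_inf_tmp => _ [pi' _ <-]; exact: (transport_cost_ge0 (d := d) pi').
apply: (@le_trans _ _ (ereal_inf S)); last by apply: ereal_inf_lbound; exists pi.
rewrite sqr_sqrtr ?fine_ge0//.
(* An infinite infimum would be sent to 0 by [fine], and the inequality would still hold. *)
by case: (ereal_inf S) S0 => //= _; exact: leey.
Qed.

Lemma couplings_product (mu nu : probability T R) :
  couplings mu nu (mu \x nu)%E.
Proof.
move=> A mA; split; rewrite /pushforward.
  rewrite (_ : fst @^-1` A = A `*` setT); last first.
    by apply/seteqP; split => -[x y] //= [].
  have := product_measure1E mu nu mA (@measurableT _ T).
  by rewrite [X in (_ * X)%E]probability_setT mule1.
rewrite (_ : snd @^-1` A = setT `*` A); last first.
  by apply/seteqP; split => -[x y] //= [].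
have := product_measure1E mu nu (@measurableT _ T) mA.
by rewrite [X in (X * _)%E]probability_setT mul1e.
Qed.

Lemma wasserstein2_near_optimal (mu nu : probability T R) (e : R) : 0 < e ->
  exists2 pi, couplings mu nu pi &
    (transport_cost (d := d) pi <= (W mu nu ^+ 2 + e)%:E)%E.
Proof.
move=> e0; rewrite /wasserstein2; set S := [set _ | _ in _].
have S0 : (0 <= ereal_inf S)%E.
  by apply: le_ereal_inf_tmp => _ [pi' _ <-]; exact: (transport_cost_ge0 (d := d) pi').
have Sfin : ereal_inf S \is a fin_num.
  rewrite ge0_fin_numE//.
  (* A partition of mesh 1 is enough to bound the cost of the product coupling, hence to make the
     infimum finite. *)
  have [n [q [y qy]]] := dq ltr01.
  apply: (@le_lt_trans _ _ (transport_cost (d := d) (mu \x nu)%E)).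
    apply: ereal_inf_lbound; exists (mu \x nu)%E => //.
    exact: couplings_product.
  have [le_s _] := transport_cost_quantized dm dD dq (mu \x nu)%E qy.
  exact: le_lt_trans le_s (ltry _).
have [_ [pi pic <-] lt_pi] := lb_ereal_inf_adherent e0 Sfin.
exists pi => //; rewrite sqr_sqrtr ?fine_ge0// EFinD fineK//.
exact: ltW lt_pi.
Qed.

(** A discrete plan on triples of cells. The relations on [W] make the weighted costs of its two
    legs at most [W g0 g1 ^+ 2] up to errors, while its endpoint cost is at least
    [W g0 g1 ^+ 2 - e]; the difference is the total excess. Marginals are tested against vectors so
    that barycenters can be read off the plan. *)
Lemma glued_plan (V : lmodType R) (g0 gt g1 : probability T R) (t e : R) :
  0 < t -> t < 1 -> 0 < e ->
  W g0 gt = t * W g0 g1 -> W gt g1 = (1 - t) * W g0 g1 ->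
  forall (I : finType) (q : T -> I) (y : I -> T) (r : R),
  quantizer (d := d) q y r -> 4 * D * r <= e ->
  exists p : I * I * I -> R, [/\ forall k, 0 <= p k,
    (forall f : I -> V,
      [/\ \sum_k p k *: f k.1.1 = \sum_i cell_mass (q := q) g0 i *: f i,
          \sum_k p k *: f k.1.2 = \sum_i cell_mass (q := q) gt i *: f i
        & \sum_k p k *: f k.2 = \sum_i cell_mass (q := q) g1 i *: f i]),
    \sum_k p k = 1,
    \sum_k p k * d (y k.1.1) (y k.2) ^+ 2
      <= W g0 g1 ^+ 2 + 2 * e / t + 2 * e / (1 - t)
    & \sum_k p k * excess (d := d) t (y k.1.1) (y k.1.2) (y k.2)
      <= e + 2 * e / t + 2 * e / (1 - t)].
Proof.
move=> t0 t1 e0 W0t Wt1 I q y r qy re; have [mq _] := qy.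
have t'0 : 0 < 1 - t by rewrite subr_gt0.
have [pi1 pi1c pi1W] := wasserstein2_near_optimal g0 gt e0.
have [pi2 pi2c pi2W] := wasserstein2_near_optimal gt g1 e0.
pose a i j := cell_mass (q := cell_pair (q := q)) pi1 (i, j).
pose b j l := cell_mass (q := cell_pair (q := q)) pi2 (j, l).
pose m j := cell_mass (q := q) gt j.
(* gluing of the two discretized plans along the law of the middle point *)
pose p (k : I * I * I) := a k.1.1 k.1.2 * b k.1.2 k.2 / m k.1.2.
have a0 i j : 0 <= a i j by exact: cell_mass_ge0.
have b0 i j : 0 <= b i j by exact: cell_mass_ge0.
have m0 j : 0 <= m j by exact: cell_mass_ge0.
have arow i : \sum_j a i j = cell_mass (q := q) g0 i.
  exact: cell_pair_mass_row mq pi1c.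
have acol j : \sum_i a i j = m j by exact: cell_pair_mass_col mq pi1c.
have brow j : \sum_l b j l = m j by exact: cell_pair_mass_row mq pi2c.
have bcol l : \sum_j b j l = cell_mass (q := q) g1 l.
  exact: cell_pair_mass_col mq pi2c.
have am i j : m j = 0 -> a i j = 0.
  move=> mj0; apply/eqP; rewrite eq_le a0 -{1}mj0 -acol (bigD1 i)//= lerDl.
  by rewrite sumr_ge0.
have bm j l : m j = 0 -> b j l = 0.
  move=> mj0; apply/eqP; rewrite eq_le b0 -{1}mj0 -brow (bigD1 l)//= lerDl.
  by rewrite sumr_ge0.
have p0 k : 0 <= p k by rewrite divr_ge0// mulr_ge0.
have pl i j : \sum_l p (i, j, l) = a i j.
  rewrite /p/= -mulr_suml -mulr_sumr brow.
  have [mj0|mj0] := eqVneq (m j) 0; first by rewrite am// !mul0r.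
  by rewrite mulfK.
have pi_ j l : \sum_i p (i, j, l) = b j l.
  rewrite /p/= -mulr_suml -mulr_suml acol.
  have [mj0|mj0] := eqVneq (m j) 0; first by rewrite bm// mulr0 mul0r.
  by rewrite mulrAC mulfV// mul1r.
(* The endpoint marginal of [p]; lifted to a coupling [rho], it yields the lower bound on the
   endpoint cost. *)
pose s i l := \sum_j p (i, j, l).
have s0 i l : 0 <= s i l by exact: sumr_ge0.
have srow i : \sum_l s i l = cell_mass (q := q) g0 i.
  by rewrite /s exchange_big/= -arow; apply: eq_bigr => j _.
have scol l : \sum_i s i l = cell_mass (q := q) g1 l.
  by rewrite /s exchange_big/= -bcol; apply: eq_bigr => j _.
have [rho rhoc rhos] := matrix_coupling mq s0 srow scol.
pose S1 := \sum_k p k * d (y k.1.1) (y k.1.2) ^+ 2.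
pose S2 := \sum_k p k * d (y k.1.2) (y k.2) ^+ 2.
pose S3 := \sum_k p k * d (y k.1.1) (y k.2) ^+ 2.
have S1E : S1 = cell_pair_sum q (fun i j => d (y i) (y j) ^+ 2) pi1.
  rewrite /S1 big_triple; apply: eq_bigr => i _; apply: eq_bigr => j _ /=.
  by rewrite -mulr_suml pl mulrC.
have S2E : S2 = cell_pair_sum q (fun i j => d (y i) (y j) ^+ 2) pi2.
  rewrite /S2 big_triple exchange_big; apply: eq_bigr => j _ /=.
  rewrite exchange_big; apply: eq_bigr => l _ /=.
  by rewrite -mulr_suml pi_ mulrC.
have S3E : S3 = cell_pair_sum q (fun i j => d (y i) (y j) ^+ 2) rho.
  rewrite /S3 big_triple; apply: eq_bigr => i _; rewrite exchange_big.
  apply: eq_bigr => l _ /=.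
  by rewrite -mulr_suml rhos mulrC.
(* One [e] comes from near optimality, the other from quantization. *)
have S1le : S1 <= t ^+ 2 * W g0 g1 ^+ 2 + 2 * e.
  have [_] := transport_cost_quantized dm dD dq pi1 qy.
  rewrite -S1E => /le_trans /(_ (leeD2r _ pi1W)).
  by rewrite -EFinD lee_fin W0t exprMn; move: re; clear; lra.
have S2le : S2 <= (1 - t) ^+ 2 * W g0 g1 ^+ 2 + 2 * e.
  have [_] := transport_cost_quantized dm dD dq pi2 qy.
  rewrite -S2E => /le_trans /(_ (leeD2r _ pi2W)).
  by rewrite -EFinD lee_fin Wt1 exprMn; move: re; clear; lra.
have S3ge : W g0 g1 ^+ 2 <= S3 + e.
  have [+ _] := transport_cost_quantized dm dD dq rho qy.
  rewrite -S3E => /(le_trans (wasserstein2_sqr_le rhoc)).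
  by rewrite lee_fin; move: re; clear; lra.
have SE : \sum_k p k * excess (d := d) t (y k.1.1) (y k.1.2) (y k.2) =
    S1 / t + S2 / (1 - t) - S3.
  rewrite /S1 /S2 /S3 !mulr_suml -sumrN -!big_split/=; apply: eq_bigr => k _.
  by rewrite /excess; ring.
have SE0 : 0 <= \sum_k p k * excess (d := d) t (y k.1.1) (y k.1.2) (y k.2).
  by apply: sumr_ge0 => k _; rewrite mulr_ge0// excess_ge0.
have S12 : S1 / t + S2 / (1 - t) <=
    W g0 g1 ^+ 2 + 2 * e / t + 2 * e / (1 - t).
  have : S1 / t <= t * W g0 g1 ^+ 2 + 2 * e / t.
    by rewrite ler_pdivrMr// mulrDl divfK ?gt_eqF// mulrAC -expr2.
  have : S2 / (1 - t) <= (1 - t) * W g0 g1 ^+ 2 + 2 * e / (1 - t).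
    by rewrite ler_pdivrMr// mulrDl divfK ?gt_eqF// mulrAC -expr2.
  move: (S1 / t) (S2 / (1 - t)) (2 * e / t) (2 * e / (1 - t)) (W g0 g1 ^+ 2).
  by clear; move=> *; lra.
exists p; split => //.
- move=> f; split; rewrite big_triple.
  + apply: eq_bigr => i _; rewrite -arow scaler_suml.
    by apply: eq_bigr => j _; rewrite -pl scaler_suml.
  + rewrite exchange_big; apply: eq_bigr => j _; rewrite -/(m j) -acol scaler_suml.
    by apply: eq_bigr => i _; rewrite -pl scaler_suml.
  + rewrite exchange_big/=.
    under eq_bigr do rewrite exchange_big/=.
    rewrite exchange_big/=.
    apply: eq_bigr => l _; rewrite -bcol scaler_suml.
    by apply: eq_bigr => j _; rewrite -pi_ scaler_suml.
- rewrite big_triple -(cell_mass_sum mq g0).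
  by apply: eq_bigr => i _; rewrite -arow; apply: eq_bigr => j _.
(* The total excess is nonnegative, so [S3 <= S1 / t + S2 / (1 - t)]. *)
- apply: le_trans S12; rewrite -subr_ge0 -/S3.
  by rewrite -SE.
- rewrite SE; move: S12 S3ge; clear.
  move: (S1 / t) (S2 / (1 - t)) (2 * e / t) (2 * e / (1 - t)) (W g0 g1 ^+ 2).
  by move=> *; lra.
Qed.

End wasserstein_gluing.

(** * Compact metric spaces *)

Section compact_metric.
Context {R : realType} {T : ptopologicalType} {d : T -> T -> R}.
Hypothesis dm : is_metric d.
Hypothesis dnbhs : forall x (e : R), 0 < e -> nbhs x [set y | d x y < e].
Hypothesis Tcompact : compact [set: T].

Let dC x y : d x y = d y x. Proof. by case: dm. Qed.
Let dtri x y z : d x z <= d x y + d y z. Proof. by case: dm. Qed.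

Lemma open_metric_ball x (e : R) : open [set y | d x y < e].
Proof.
rewrite openE => y /= xy; rewrite /interior.
have := dnbhs y (_ : 0 < e - d x y); rewrite subr_gt0 => /(_ xy).
apply: filterS => z /=; have := dtri x y z; lra.
Qed.

Lemma compact_metric_bounded : exists D, forall x y, d x y <= D.
Proof.
have x0 : T by exact: point.
(* Near-covering form of compactness with an integer parameter: a property that holds near each
   point for all large [n] holds everywhere for some [n]. *)
have /compact_near_coveringP/(_ nat \oo (fun n y => d x0 y <= n%:R)) := Tcompact.
case=> [y _|N _ NP].
  near=> z n => /=.
  apply: (@le_trans _ _ (d x0 y + 1)).
    apply: le_trans (dtri _ y _) _; rewrite lerD2l ltW//.
    by near: z; exact: dnbhs.
  by near: n; exact: nbhs_infty_ger.
exists (N%:R + N%:R) => x y; apply: le_trans (dtri _ x0 _) _.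
by rewrite dC lerD// (NP N)//=.
Unshelve. all: by end_near. Qed.

Lemma compact_metric_quantizable :
  quantizable (T := g_sigma_algebraType (@open T)) (d := d).
Proof.
move=> e e0.
have : cover_compact [set: T] by rewrite -compact_cover.
move=> /(_ T setT (fun x => [set y | d x y < e])).
case=> [x _|x _|A _ Acover]; first exact: open_metric_ball.
  by exists x => //=; rewrite metric_refl.
pose s := finmap.enum_fset A.
have sP x : has (fun y => d y x < e) s.
  have [y yA yx] := Acover x I.
  by apply/hasP; exists y.
(* Each point goes to the first ball of the finite subcover containing it, so a cell is an open ball
   minus the earlier ones. *)
pose q x := find (fun y => d y x < e) s.
have qs x : (q x < size s)%N by rewrite -has_find.
exists (size s), (fun x => Ordinal (qs x)), (fun i => nth point s i); split; last first.
  by move=> x; rewrite ltW//=; exact: (nth_find point (sP x)).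
pose S := g_sigma_algebraType (@open T).
have mball y : measurable ([set x | d y x < e] : set S).
  by apply: sub_sigma_algebra; exact: open_metric_ball.
move=> i.
rewrite (_ : _ @^-1` _ = [set x | d (nth point s i) x < e] `&`
    \bigcap_(j in [set j | (j < i)%N]) ~` [set x | d (nth point s j) x < e]).
  apply: measurableI => //; apply: bigcap_measurableType => j _.
  exact: measurableC.
apply/seteqP; split => x /=.
  move=> <- /=; split; first exact: (nth_find point (sP x)).
  by move=> j /= jq; apply/negP/negbT; exact: (before_find point jq).
move=> [xi xj]; apply/val_inj => /=; apply/eqP; rewrite eqn_leq; apply/andP; split.
  rewrite leqNgt; apply/negP => iq.
  by have := before_find point iq; rewrite xi.
rewrite leqNgt; apply/negP => qi; apply: (xj _ qi).
exact: (nth_find point (sP x)).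
Qed.

Lemma metric_continuous : continuous (fun p : T * T => d p.1 p.2).
Proof.
move=> [x y]; apply/cvgrPdist_lt => e e0 /=.
have e2 : 0 < e / 2 by rewrite divr_gt0.
exists ([set x' | d x x' < e / 2], [set y' | d y y' < e / 2]).
  by split; exact: dnbhs.
move=> [x' y'] [/= xx' yy'].
rewrite ltr_norml; apply/andP; split.
- have := dtri x' x y'; have := dtri x y y'; rewrite (dC x' x); lra.
- have := dtri x x' y; have := dtri x' y' y; rewrite (dC y' y); lra.
Qed.

Lemma metric_cvg {S : Type} {G : set_system S} {FG : Filter G}
    (f g : S -> T) x y : f @ G --> x -> g @ G --> y ->
  (fun s => d (f s) (g s)) @ G --> d x y.
Proof.
by move=> fx gy; exact: (continuous2_cvg _ (@metric_continuous (x, y)) fx gy).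
Qed.

Let sqr_metric_cvg {S : Type} {G : set_system S} {FG : Filter G}
    (f g : S -> T) x y : f @ G --> x -> g @ G --> y ->
  (fun s => d (f s) (g s) ^+ 2) @ G --> d x y ^+ 2.
Proof.
move=> fx gy; rewrite expr2; under eq_fun do rewrite expr2.
by apply: cvgM; exact: metric_cvg.
Qed.

Lemma lipschitz_continuous {V : normedModType R} (f : T -> V) (C : R) :
  (forall x y, `|f x - f y| <= C * d x y) -> continuous f.
Proof.
move=> fC x; apply/cvgrPdist_lt => e e0.
have C0 : 0 < `|C| + 1 by rewrite ltr_wpDl.
have := dnbhs x (_ : 0 < e / (`|C| + 1)); rewrite divr_gt0// => /(_ isT).
apply: filterS => y /=; rewrite ltr_pdivlMr// => dxy.
apply: le_lt_trans (fC x y) _; apply: le_lt_trans dxy.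
rewrite mulrC ler_wpM2l ?metric_ge0//.
by apply: le_trans (ler_norm C) _; rewrite lerDl.
Qed.

(* Compactness turns an estimate on exact [t]-intermediate points into one on
   all triples, at the price of a small error and a multiple of the excess. *)
Lemma excess_relaxation {V : normedModType R} (f : T -> V) (C M t : R) :
  (forall x y, `|f x - f y| <= C * d x y) -> 0 < t -> t < 1 ->
  (forall x z y, d x z = t * d x y -> d z y = (1 - t) * d x y ->
    `|f z - (1 - t) *: f x - t *: f y| <= M * d x y ^+ 2) ->
  forall e : R, 0 < e -> exists N : nat, forall x z y,
    `|f z - (1 - t) *: f x - t *: f y| <=
    M * d x y ^+ 2 + e + N%:R * excess (d := d) t x z y.
Proof.
move=> fC t0 t1 fM e e0.
have fcont := lipschitz_continuous fC.
pose h (p : T * T * T) := `|f p.1.2 - (1 - t) *: f p.1.1 - t *: f p.2|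
  - M * d p.1.1 p.2 ^+ 2.
pose E (p : T * T * T) := excess (d := d) t p.1.1 p.1.2 p.2.
have c11 (p : T * T * T) : p'.1.1 @[p' --> p] --> p.1.1.
  by apply: (cvg_comp (@fst _ _) (@fst _ _)); exact: cvg_fst.
have c12 (p : T * T * T) : p'.1.2 @[p' --> p] --> p.1.2.
  by apply: (cvg_comp (@fst _ _) (@snd _ _)); [exact: cvg_fst|exact: cvg_snd].
have c2 (p : T * T * T) : p'.2 @[p' --> p] --> p.2 by exact: cvg_snd.
have Econt : continuous E.
  move=> p; rewrite /E /excess.
  apply: cvgB; [apply: cvgD|].
  - by apply: cvgMr_tmp; exact: (sqr_metric_cvg (c11 p) (c12 p)).
  - by apply: cvgMr_tmp; exact: (sqr_metric_cvg (c12 p) (c2 p)).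
  - exact: (sqr_metric_cvg (c11 p) (c2 p)).
have hcont : continuous h.
  move=> p; rewrite /h; apply: cvgB; last first.
    by apply: cvgMl_tmp; exact: (sqr_metric_cvg (c11 p) (c2 p)).
  apply: cvg_norm; apply: cvgB; [apply: cvgB|].
  - exact: (cvg_comp _ _ (c12 p) (fcont p.1.2)).
  - by apply: cvgZl_tmp; exact: (cvg_comp _ _ (c11 p) (fcont p.1.1)).
  - by apply: cvgZl_tmp; exact: (cvg_comp _ _ (c2 p) (fcont p.2)).
have E0 p : 0 <= E p by exact: excess_ge0.
have : compact [set: T * T * T] by rewrite -!setXTT; do 2?apply: compact_setX.
move=> /compact_near_coveringP/(_ nat \oo (fun n p => h p <= e + n%:R * E p)).
case=> [p _|N _ NP].
  (* At zero excess the triple is exactly intermediate, so [h p <= 0] and the slack [e] covers a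
     neighbourhood. At positive excess [E] stays above [E p / 2] nearby, and a large multiple of it
     dominates [h]. *)
  have [Ep|Ep] := eqVneq (E p) 0.
    have hp : h p < e.
      rewrite /h; apply: le_lt_trans e0; rewrite subr_le0.
      have [] := excess_le0 (d := d) dm t0 t1 (_ : excess t p.1.1 p.1.2 p.2 <= 0).
        by rewrite -/(E p) Ep.
      exact: fM.
    near=> p' n => /=; apply: (@le_trans _ _ e); last by rewrite lerDl mulr_ge0.
    by rewrite ltW//; near: p'; apply: (@cvgr_lt _ _ _ _ h (h p)); [exact: hcont|].
  have {}Ep : 0 < E p by rewrite lt_def Ep E0.
  near=> p' n => /=.
  have hp' : h p' <= h p + 1.
    rewrite ltW//; near: p'; apply: (@cvgr_lt _ _ _ _ h (h p)); first exact: hcont.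
    by rewrite ltrDl.
  have Ep' : E p / 2 <= E p'.
    rewrite ltW//; near: p'; apply: (@cvgr_gt _ _ _ _ E (E p)); first exact: Econt.
    by rewrite ltr_pdivrMr// ltr_pMr// ltr1n.
  have : (h p + 1) / (E p / 2) <= n%:R by near: n; exact: nbhs_infty_ger.
  rewrite ler_pdivrMr ?divr_gt0// => hn.
  apply: le_trans hp' _; apply: le_trans hn _.
  by apply: le_trans (ler_wpM2l _ Ep') _ => //; rewrite lerDr ltW.
exists N => x z y.
have := NP N (leqnn N) (x, z, y) I; rewrite /h /E/=; lra.
Unshelve. all: by end_near. Qed.

End compact_metric.

(** * Second differences of barycenters along Wasserstein geodesics *)

Section barycenter.
Context {dsp : measure_display} {T : measurableType dsp} {R : realType}.
Context {d : T -> T -> R} {D : R} {V : normedModType R}.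
Hypothesis dm : is_metric d.
Hypothesis dD : forall x y, d x y <= D.
Hypothesis dq : quantizable (d := d).

(* What is needed of [A nu] = int f dnu: quantizing [T] with mesh [r] moves it by
   at most [C r], for a [C]-Lipschitz [f]. *)
Definition barycentric (f : T -> V) (A : probability T R -> V) (C : R) :=
  forall nu n (q : T -> 'I_n) (y : 'I_n -> T) (r : R),
    quantizer (d := d) q y r ->
    `|A nu - \sum_i cell_mass (q := q) nu i *: f (y i)| <= C * r.

(** Up to quantization errors, the second difference of [A] is the average of those of [f] under a
    glued plan. There the squared endpoint distance averages to at most the squared Wasserstein
    distance plus a small error, and the total excess is small enough to absorb the factor [N]. *)
Lemma barycenter_second_difference (f : T -> V) (A : probability T R -> V)
    (C M t : R) (g0 gt g1 : probability T R) :
  barycentric f A C -> 0 <= M -> 0 < t -> t < 1 ->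
  wasserstein2 d g0 gt = t * wasserstein2 d g0 g1 ->
  wasserstein2 d gt g1 = (1 - t) * wasserstein2 d g0 g1 ->
  (forall e : R, 0 < e -> exists N : nat, forall x z y,
    `|f z - (1 - t) *: f x - t *: f y| <=
    M * d x y ^+ 2 + e + N%:R * excess (d := d) t x z y) ->
  `|A gt - (1 - t) *: A g0 - t *: A g1| <= M * wasserstein2 d g0 g1 ^+ 2.
Proof.
move=> fA M0 t0 t1 W0t Wt1 fe.
have t'0 : 0 < 1 - t by rewrite subr_gt0.
apply/ler_addgt0Pr => e e0.
have e4 : 0 < e / 4 by rewrite divr_gt0.
have [N fN] := fe _ e4.
(* [b * e'] bounds the errors of the glued plan. [e'] is chosen after [N] so that
   [(M + N%:R) * (b * e')] is at most [e / 4], and [r] so that the plan exists and each barycenter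
   is off by at most [e / 8]. *)
pose b := 1 + 2 / t + 2 / (1 - t).
have b0 : 0 < b by rewrite !addr_gt0 ?divr_gt0.
pose e' := e / 4 / ((M + N%:R + 1) * b).
have MN0 : 0 < M + N%:R + 1 by rewrite ltr_wpDl// addr_ge0.
have e'0 : 0 < e' by rewrite divr_gt0// mulr_gt0.
pose r := Num.min (e' / (4 * `|D| + 1)) (e / 8 / (`|C| + 1)).
have D0 : 0 < 4 * `|D| + 1 by rewrite ltr_wpDl// mulr_ge0.
have C0 : 0 < `|C| + 1 by rewrite ltr_wpDl.
have r0 : 0 < r.
  by rewrite lt_min (divr_gt0 e'0 D0) divr_gt0// divr_gt0.
have [n [q [y qy]]] := dq r0.
have Dr : 4 * D * r <= e'.
  apply: (@le_trans _ _ ((4 * `|D| + 1) * r)).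
    rewrite ler_wpM2r ?(ltW r0)//.
    by have := ler_norm D; lra.
  by rewrite mulrC -ler_pdivlMr// ge_min lexx.
have Cr : C * r <= e / 8.
  apply: (@le_trans _ _ ((`|C| + 1) * r)).
    rewrite ler_wpM2r ?(ltW r0)//.
    by have := ler_norm C; lra.
  by rewrite mulrC -ler_pdivlMr// ge_min lexx orbT.
have [p [p0 pE p1 pd pe]] := glued_plan dm dD dq V t0 t1 e'0 W0t Wt1 qy Dr.
have [p0E ptE p1E] := pE (f \o y).
have be' : (M + N%:R) * (b * e') <= e / 4.
  have -> : (M + N%:R) * (b * e') = e / 4 * ((M + N%:R) / (M + N%:R + 1)).
    by rewrite /e'; field; rewrite !gt_eqF.
  rewrite ler_piMr ?(ltW e4)// ler_pdivrMr// mul1r; lra.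
have bE : b * e' = e' + 2 * e' / t + 2 * e' / (1 - t).
  by rewrite /b; field; rewrite !gt_eqF.
set w := wasserstein2 d g0 g1 in pd *.
have S_le :
    `|\sum_k p k *: (f (y k.1.2) - (1 - t) *: f (y k.1.1) - t *: f (y k.2))|
    <= M * w ^+ 2 + e / 2.
  apply: le_trans (ler_norm_sum _ _ _) _.
  apply: (@le_trans _ _ (\sum_k p k *
    (M * d (y k.1.1) (y k.2) ^+ 2 + e / 4 +
     N%:R * excess (d := d) t (y k.1.1) (y k.1.2) (y k.2)))).
    apply: ler_sum => k _; rewrite normrZ ger0_norm// ler_wpM2l//.
  rewrite [leLHS](_ : _ = M * (\sum_k p k * d (y k.1.1) (y k.2) ^+ 2)
    + (\sum_k p k) * (e / 4) + N%:R *
    (\sum_k p k * excess (d := d) t (y k.1.1) (y k.1.2) (y k.2))); last first.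
    rewrite !mulr_sumr mulr_suml -!big_split/=; apply: eq_bigr => k _; ring.
  rewrite p1 mul1r.
  have := ler_wpM2l M0 pd; have := ler_wpM2l (ler0n R N) pe; rewrite -bE.
  have : M * (w ^+ 2 + 2 * e' / t + 2 * e' / (1 - t)) <= M * w ^+ 2 + M * (b * e').
    by rewrite -mulrDr ler_wpM2l// bE; lra.
  move: be'; rewrite mulrDl; clear; move=> *; lra.
(* Each barycenter is compared with its quantized sum; the three sums are marginals of [p] and
   combine into a single sum of second differences. *)
rewrite [X in `|X|](_ : _ =
  (A gt - \sum_i cell_mass (q := q) gt i *: f (y i))
  - (1 - t) *: (A g0 - \sum_i cell_mass (q := q) g0 i *: f (y i))
  - t *: (A g1 - \sum_i cell_mass (q := q) g1 i *: f (y i))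
  + \sum_k p k *: (f (y k.1.2) - (1 - t) *: f (y k.1.1) - t *: f (y k.2)));
  last first.
  have -> : \sum_k p k *: (f (y k.1.2) - (1 - t) *: f (y k.1.1) - t *: f (y k.2))
    = \sum_i cell_mass (q := q) gt i *: f (y i)
      - (1 - t) *: \sum_i cell_mass (q := q) g0 i *: f (y i)
      - t *: \sum_i cell_mass (q := q) g1 i *: f (y i).
    rewrite -p0E -ptE -p1E !scaler_sumr -!sumrB; apply: eq_bigr => k _ /=.
    by rewrite !scalerBr !scalerA ![p k * _]mulrC.
  rewrite !scalerBr.
  move: (A gt) (_ *: A g0) (_ *: A g1).
  move: (\sum_i _ *: _) (_ *: \sum_i _) (_ *: \sum_i _).
  move=> s1 s2 s3 a1 a2 a3.
  rewrite !opprB.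
  rewrite [RHS](AC (2*2*2*3) (1*4*6*(2*7)*(3*8)*(5*9)))/=.
  by rewrite addNr subrr subrr !addr0.
apply: le_trans (ler_normD _ _) _.
rewrite [leRHS](_ : _ = e / 2 + (M * w ^+ 2 + e / 2)); last by field.
apply: lerD S_le.
apply: le_trans (ler_normB _ _) _.
apply: le_trans (lerD (ler_normB _ _) (lexx _)) _.
rewrite !normrZ (gtr0_norm t0) (gtr0_norm t'0).
have q0 := fA g0 _ _ _ _ qy; have qt := fA gt _ _ _ _ qy.
have q1 := fA g1 _ _ _ _ qy.
have := ler_wpM2l (ltW t0) q1; have := ler_wpM2l (ltW t'0) q0.
move: Cr qt e0 => Cr qt e0 h0 h1.
apply: le_trans (lerD (lerD qt h0) h1) _.
rewrite [leLHS](_ : _ = 2 * (C * r)); last by ring.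
move: Cr e0; clear; lra.
Qed.

End barycenter.

(** * Bochner integrals of Lipschitz maps *)

Section simple_functions.
Context {dsp : measure_display} {T : measurableType dsp} {R : realType}.
Context {Y : normedModType R} {P : probability T R}.
Implicit Types u v : simple_fun (T := T) (R := R) (Y := Y).

(** The sets of a simple function may overlap. Membership vectors cut [T] into disjoint cells on
    which it is constant, and on these the triangle inequality for the integral is that of a finite
    sum. *)
Definition simple_atom u (x : T) : {ffun 'I_(simple_size u) -> bool} :=
  [ffun i => x \in simple_set i].

Definition simple_atom_val u (a : {ffun 'I_(simple_size u) -> bool}) : Y :=
  \sum_(i | a i) simple_val i.

Lemma simple_evalE u x : simple_eval u x = simple_atom_val (simple_atom u x).
Proof.
rewrite /simple_eval /simple_atom_val [RHS]big_mkcond/=.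
apply: eq_bigr => i _; rewrite ffunE indicE.
by case: (x \in _); rewrite ?scale1r ?scale0r.
Qed.

Lemma measurable_simple_atom u a : measurable (simple_atom u @^-1` [set a]).
Proof.
rewrite (_ : _ @^-1` _ = \bigcap_(i in [set: 'I_(simple_size u)])
    (if a i then simple_set i else ~` simple_set i)).
  apply: fin_bigcap_measurable => [|i _]; first exact: finite_finset.
  by case: (a i); [|apply: measurableC]; exact: simple_measurable.
apply/seteqP; split => x /=.
  move=> <- i _; rewrite ffunE; case: ifPn => [|/negP]; first by rewrite inE.
  by rewrite inE.
move=> xa; apply/ffunP => i; rewrite ffunE.
have := xa i I; case: (a i) => [xi|xi]; first exact: mem_set.
exact: memNset.
Qed.

Lemma simple_integralE u : simple_integral P u =
  \sum_a cell_mass (q := simple_atom u) P a *: simple_atom_val a.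
Proof.
rewrite /simple_integral /simple_atom_val.
transitivity (\sum_(a : {ffun 'I_(simple_size u) -> bool}) \sum_(i < simple_size u)
    (if a i then cell_mass (q := simple_atom u) P a else 0) *: simple_val i);
    last first.
  apply: eq_bigr => a _; rewrite scaler_sumr [RHS]big_mkcond/=.
  by apply: eq_bigr => i _; case: (a i); rewrite ?scale0r.
rewrite exchange_big/=; apply: eq_bigr => i _; rewrite -scaler_suml.
congr (_ *: _).
rewrite (cell_decomposition (q := simple_atom u) (@measurable_simple_atom u) P
  (simple_measurable i))/=.
apply: eq_bigr => a _; case: ifPn => ai.
  congr (fine (P _)); apply/seteqP; split => x /= [] //.
  by move=> xa; split => //; move: ai; rewrite -xa ffunE inE.
rewrite (_ : _ `&` _ = set0) ?measure0//.
apply/seteqP; split => x //= [xa xi].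
by move: ai; rewrite -xa ffunE => /negP; apply; exact: mem_set.
Qed.

Lemma measurable_simple_comp u (h : Y -> R) :
  measurable_fun [set: T] (h \o simple_eval u).
Proof.
rewrite (_ : h \o _ = (h \o @simple_atom_val u) \o simple_atom u).
  exact: (measurable_step (@measurable_simple_atom u)).
by apply/funext => x /=; rewrite simple_evalE.
Qed.

Lemma norm_simple_integral u :
  (`|simple_integral P u|%:E <= \int[P]_x `|simple_eval u x|%:E)%E.
Proof.
under eq_integral do rewrite simple_evalE.
rewrite (integral_step (@measurable_simple_atom u) P
  (h := fun a => `|simple_atom_val a|))// lee_fin.
rewrite simple_integralE; apply: le_trans (ler_norm_sum _ _ _) _.
apply: ler_sum => a _; rewrite normrZ ger0_norm ?cell_mass_ge0// setIT.
by rewrite mulrC.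
Qed.

Definition simple_sub u v : simple_fun (T := T) (R := R) (Y := Y) :=
  let A k := match fintype.split k with inl i => simple_set (s := u) i
                              | inr j => simple_set (s := v) j end in
  let c k := match fintype.split k with inl i => simple_val (s := u) i
                              | inr j => - simple_val (s := v) j end in
  let mA k : measurable (A k) :=
    match fintype.split k as w return measurable
      match w with inl i => simple_set (s := u) i
                 | inr j => simple_set (s := v) j end
    with inl i => simple_measurable i | inr j => simple_measurable j end in
  @SimpleFun _ _ _ Y (simple_size u + simple_size v)%N A c mA.

Lemma simple_eval_sub u v x :
  simple_eval (simple_sub u v) x = simple_eval u x - simple_eval v x.
Proof.
rewrite /simple_eval/= big_split_ord/= -sumrN; congr (_ + _).
  by apply: eq_bigr => i _; rewrite (unsplitK (inl i)).
by apply: eq_bigr => i _; rewrite (unsplitK (inr i)) scalerN.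
Qed.

Lemma simple_integral_sub u v :
  simple_integral P (simple_sub u v) = simple_integral P u - simple_integral P v.
Proof.
rewrite /simple_integral/= big_split_ord/= -sumrN; congr (_ + _).
  by apply: eq_bigr => i _; rewrite (unsplitK (inl i)).
by apply: eq_bigr => i _; rewrite (unsplitK (inr i)) scalerN.
Qed.

Lemma norm_simple_integral_sub u v :
  (`|simple_integral P u - simple_integral P v|%:E <=
    \int[P]_x `|simple_eval u x - simple_eval v x|%:E)%E.
Proof.
rewrite -simple_integral_sub; apply: le_trans (norm_simple_integral _) _.
by under eq_integral do rewrite simple_eval_sub.
Qed.

End simple_functions.

Section bochner_lipschitz.
Context {dsp : measure_display} {T : measurableType dsp} {R : realType}.
Context {d : T -> T -> R} {Y : completeNormedModType R}.
Hypothesis dq : quantizable (d := d).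
Context {f : T -> Y} {C : R}.
Hypothesis C0 : 0 < C.
Hypothesis fC : forall x y, `|f x - f y| <= C * d x y.

Definition quantized_simple n (q : T -> 'I_n) (y : 'I_n -> T)
    (mq : forall i, measurable (q @^-1` [set i])) :
    simple_fun (T := T) (R := R) (Y := Y) :=
  @SimpleFun _ _ _ Y n (fun i => q @^-1` [set i]) (f \o y) mq.

Lemma quantized_simple_eval n (q : T -> 'I_n) (y : 'I_n -> T)
    (mq : forall i, measurable (q @^-1` [set i])) x :
  simple_eval (quantized_simple y mq) x = f (y (q x)).
Proof.
rewrite /simple_eval/= (bigD1 (q x))//= big1 => [|i iq].
  by rewrite addr0 indicE mem_set// scale1r.
by rewrite indicE memNset ?scale0r//= => /eqP; rewrite eq_sym (negbTE iq).
Qed.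

Lemma quantized_simple_dist n (q : T -> 'I_n) y (r : R)
    (qy : quantizer (d := d) q y r) x :
  `|f x - simple_eval (quantized_simple y qy.1) x| <= C * r.
Proof.
rewrite quantized_simple_eval distrC; apply: le_trans (fC _ _) _.
by rewrite ler_wpM2l ?(ltW C0)//; case: qy.
Qed.

(** Quantizations of [f] approximate it uniformly, so this real function is a uniform limit of step
    functions. *)
Lemma measurable_dist_simple (u : simple_fun (T := T) (R := R) (Y := Y)) :
  measurable_fun [set: T] (fun x => `|f x - simple_eval u x|).
Proof.
apply: measurable_fun_uniform_limit => e e0.
have [|n [q [y qy]]] := dq (e := e / C); first by rewrite divr_gt0.
exists (fun x => `|simple_eval (simple_sub (quantized_simple y qy.1) u) x|).
  exact: (measurable_simple_comp _ (fun y : Y => `|y|)).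
move=> x; rewrite simple_eval_sub; apply: le_trans (ler_dist_dist _ _) _.
rewrite opprB addrA subrK distrC.
by apply: le_trans (quantized_simple_dist qy x) _; rewrite mulrC divfK ?gt_eqF.
Qed.

Lemma integral_dist_quantized (P : probability T R) n (q : T -> 'I_n) y (r : R)
    (qy : quantizer (d := d) q y r) u :
  (\int[P]_x `|simple_eval u x - simple_eval (quantized_simple y qy.1) x|%:E
    <= \int[P]_x `|f x - simple_eval u x|%:E + (C * r)%:E)%E.
Proof.
have Cr0 : 0 <= C * r.
  exact: le_trans (normr_ge0 _) (quantized_simple_dist qy point).
have cE := integral_cst_probability P (C * r).
have mu : measurable_fun [set: T] (fun x => (`|f x - simple_eval u x|)%:E).
  exact/measurable_EFinP/measurable_dist_simple.
rewrite -cE -ge0_integralD//.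
apply: ge0_le_integral => //.
- apply/measurable_EFinP; under eq_fun do rewrite -simple_eval_sub.
  exact: (measurable_simple_comp _ (fun y : Y => `|y|)).
- exact: emeasurable_funD.
- move=> x _; rewrite -EFinD lee_fin distrC.
  have -> : simple_eval (quantized_simple y qy.1) x - simple_eval u x =
    (f x - simple_eval u x) - (f x - simple_eval (quantized_simple y qy.1) x).
    by rewrite opprB [RHS]addrC addrA subrK.
  apply: le_trans (ler_normB _ _) _; rewrite lerD2l.
  exact: quantized_simple_dist.
Qed.

(** A late term of the approximating sequence and the quantized simple function are both close to
    [f] in mean, hence have close integrals. The claim covers every admissible [v], in particular
    the one selected by [xget]. *)
Lemma is_bochner_integral_quantized (P : probability T R) v n (q : T -> 'I_n) y
    (r : R) : is_bochner_integral P f v -> quantizer (d := d) q y r ->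
  `|v - \sum_i cell_mass (q := q) P i *: f (y i)| <= C * r.
Proof.
move=> [s [_ s0 sv]] qy; apply/ler_addgt0Pr => e e0.
have e2 : 0 < e / 2 by rewrite divr_gt0.
have : \forall n \near \oo,
    (\int[P]_x `|f x - simple_eval (s n) x|%:E < (e / 2)%:E)%E.
  have /fine_cvgP[fin s0'] := s0.
  have : \forall n \near \oo,
      fine (\int[P]_x `|f x - simple_eval (s n) x|%:E)%E < e / 2.
    exact: (cvgr_lt _ s0' _ e2).
  move: fin; apply: filterS2 => k fin lt_k.
  by rewrite -(fineK fin) lte_fin.
have : \forall n \near \oo, `|v - simple_integral P (s n)| < e / 2.
  by move/cvgrPdist_lt : sv; apply.
move=> near_v near_f.
have [m [vm fm]] : exists m, `|v - simple_integral P (s m)| < e / 2 /\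
    (\int[P]_x `|f x - simple_eval (s m) x|%:E < (e / 2)%:E)%E.
  by have [m []] := filter_ex (filterI near_v near_f); exists m.
rewrite [leRHS](_ : _ = e / 2 + (e / 2 + C * r)); last by field.
rewrite -(subrK (simple_integral P (s m)) v) -addrA.
apply: le_trans (ler_normD _ _) _; apply: lerD; first exact: ltW.
rewrite -lee_fin EFinD.
apply: le_trans (norm_simple_integral_sub (s m) (quantized_simple y qy.1)) _.
apply: le_trans (integral_dist_quantized P qy (s m)) _.
by rewrite leeD2r// ltW.
Qed.

(** Quantizations of mesh tending to 0 converge uniformly, so their integrals form a Cauchy
    sequence, which converges because [Y] is complete. *)
Lemma is_bochner_integral_ex (P : probability T R) :
  exists v, is_bochner_integral P f v.
Proof.
have r0 (k : nat) : 0 < k.+1%:R^-1 / C :> R by rewrite divr_gt0// invr_gt0.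
have /choice[s sP] : forall k : nat,
    exists u : simple_fun (T := T) (R := R) (Y := Y),
    forall x, `|f x - simple_eval u x| <= k.+1%:R^-1.
  move=> k; have [n [q [y qy]]] := dq (r0 k).
  exists (quantized_simple y qy.1) => x.
  apply: le_trans (quantized_simple_dist qy x) _.
  by rewrite mulrC divfK ?gt_eqF.
have int_le k : (\int[P]_x `|f x - simple_eval (s k) x|%:E <= (k.+1%:R^-1)%:E)%E.
  have cE := integral_cst_probability P k.+1%:R^-1.
  rewrite -cE; apply: ge0_le_integral => //.
    exact/measurable_EFinP/measurable_dist_simple.
  by move=> x _; rewrite lee_fin.
have dist_le k l : `|simple_integral P (s k) - simple_integral P (s l)| <=
    k.+1%:R^-1 + l.+1%:R^-1.
  rewrite -lee_fin; apply: le_trans (norm_simple_integral_sub _ _) _.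
  have cE := integral_cst_probability P (k.+1%:R^-1 + l.+1%:R^-1).
  rewrite -cE; apply: ge0_le_integral => //.
    apply/measurable_EFinP; under eq_fun do rewrite -simple_eval_sub.
    exact: (measurable_simple_comp _ (fun y : Y => `|y|)).
  move=> x _; rewrite lee_fin -(subrK (f x) (simple_eval (s k) x)) -addrA.
  by apply: le_trans (ler_normD _ _) _; rewrite distrC lerD.
have /cauchy_cvgP sv : cauchy (simple_integral P (s n) @[n --> \oo]).
  apply: cauchy_exP => e e0.
  have e2 : 0 < e / 2 by rewrite divr_gt0.
  have [N _ NP] := near_infty_natSinv_lt (PosNum e2).
  exists (simple_integral P (s N)); exists N => // k /= Nk.
  rewrite -ball_normE/=; apply: le_lt_trans (dist_le _ _) _.
  have lN : N.+1%:R^-1 < e / 2 by exact: (NP N (leqnn N)).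
  have lk : k.+1%:R^-1 < e / 2 by exact: (NP k Nk).
  by rewrite (splitr e) ltrD.
exists (lim (simple_integral P (s n) @[n --> \oo])); exists s; split => //.
  apply/aeW => x; apply/cvgrPdist_lt => e e0; near=> k.
  apply: le_lt_trans (sP k x) _.
  by near: k; exact: (near_infty_natSinv_lt (PosNum e0)).
apply: (@squeeze_cvge _ _ _ _ (cst 0%E) _ (fun k => (k.+1%:R^-1)%:E)).
- apply: nearW => k; rewrite int_le andbT.
  by apply: integral_ge0 => x _; rewrite lee_fin.
- exact: cvg_cst.
- apply: cvg_EFin; first exact: nearW.
  exact: cvg_harmonic.
Unshelve. all: by end_near. Qed.

Lemma barycentric_bochner_integral :
  barycentric (d := d) f (fun P => bochner_integral P f) C.
Proof.
move=> P n q y r qy; apply: is_bochner_integral_quantized qy.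
(* Existence makes [xget] return an actual integral instead of the default 0. *)
exact: (xgetPex 0 (is_bochner_integral_ex P)).
Qed.

End bochner_lipschitz.

Section Rintegral_barycenter.
Context {dsp : measure_display} {T : measurableType dsp} {R : realType}.
Context {d : T -> T -> R}.
Hypothesis dq : quantizable (d := d).

Lemma barycentric_Rintegral (f : T -> R) (C : R) : 0 < C ->
  (forall x, 0 <= f x) -> (forall x y, `|f x - f y| <= C * d x y) ->
  barycentric (V := R^o) (d := d) f (fun P => \int[P]_x f x) C.
Proof.
move=> C0 f0 fC P n q y r qy; have [mq yr] := qy.
have fyr x : `|f (y (q x)) - f x| <= C * r.
  by apply: le_trans (fC _ _) _; rewrite ler_wpM2l ?(ltW C0).
have Cr0 : 0 <= C * r by exact: le_trans (normr_ge0 _) (fyr point).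
have mf : measurable_fun [set: T] (fun x => (f x)%:E).
  apply/measurable_EFinP; apply: measurable_fun_uniform_limit => e e0.
  have [|n' [q' [y' [mq' yr']]]] := dq (e := e / C); first by rewrite divr_gt0.
  exists ((f \o y') \o q'); first exact: (measurable_step mq').
  move=> x; apply: le_trans (fC _ _) _.
  by rewrite mulrC -ler_pdivlMr.
have mfq : measurable_fun [set: T] (fun x => (f (y (q x)))%:E).
  by apply/measurable_EFinP; exact: (measurable_step mq (f \o y)).
pose s := \sum_i cell_mass (q := q) P i * f (y i).
have sE : (\int[P]_x (f (y (q x)))%:E)%E = s%:E.
  rewrite (integral_step mq P (h := f \o y))//; last by move=> i /=.
  by congr (_%:E); apply: eq_bigr => i _; rewrite setIT mulrC.
have cE := integral_cst_probability P (C * r).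
have ge0f x : (0 <= (f x)%:E)%E by rewrite lee_fin.
have ge0c (x : T) : (0 <= (C * r)%:E)%E by rewrite lee_fin.
have le1 : (\int[P]_x (f x)%:E <= s%:E + (C * r)%:E)%E.
  rewrite -sE -cE -ge0_integralD//.
  apply: ge0_le_integral => //; first exact: emeasurable_funD.
  move=> x _; rewrite -EFinD lee_fin.
  by have := fyr x; rewrite ler_distl lerBlDr => /andP[].
have le2 : (s%:E <= \int[P]_x (f x)%:E + (C * r)%:E)%E.
  rewrite -sE -cE -ge0_integralD//.
  apply: ge0_le_integral => //; first exact: emeasurable_funD.
  move=> x _; rewrite -EFinD lee_fin.
  by have := fyr x; rewrite ler_distl => /andP[].
have fin : (\int[P]_x (f x)%:E)%E \is a fin_num.
  rewrite ge0_fin_numE; first by apply: le_lt_trans le1 _; rewrite -EFinD ltry.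
  by apply: integral_ge0 => x _; rewrite lee_fin.
rewrite /Rintegral; move: le1 le2; rewrite -(fineK fin) -!EFinD !lee_fin => le1 le2.
by rewrite ler_distl lerBlDr; apply/andP; split.
Qed.

End Rintegral_barycenter.

(** * Convex functions *)

Section convex_combinations.
Context {R : realType} {Y : lmodType R}.

Lemma convex_combination_in (S : set Y) (I : Type) (r : seq I) (p : I -> R)
    (v : I -> Y) (w : Y) :
  (forall x y (t : R), S x -> S y -> 0 <= t -> t <= 1 ->
    S ((1 - t) *: x + t *: y)) ->
  (forall i, 0 <= p i) -> (forall i, S (v i)) -> S w ->
  \sum_(i <- r) p i <= 1 ->
  S (\sum_(i <- r) p i *: v i + (1 - \sum_(i <- r) p i) *: w).
Proof.
(* the head is absorbed into [w], which keeps the other weights unchanged *)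
move=> Sconv p0 Sv; elim: r w => [|i r IH] w Sw.
  by rewrite !big_nil subr0 scale1r add0r.
rewrite !big_cons; set s := \sum_(j <- r) p j => ps.
have s1 : p i <= 1 - s by lra.
(* If [1 - s = 0] then [p i = 0] as well, and the quotient is 0 by convention. *)
have pE : (1 - s) * (p i / (1 - s)) = p i.
  have [s0|s0] := eqVneq (1 - s) 0; last by rewrite mulrC divfK.
  by rewrite s0 mul0r; apply/eqP; rewrite eq_le p0 -s0 s1.
have t1 : p i / (1 - s) <= 1.
  have [->|s0] := eqVneq (1 - s) 0; first by rewrite invr0 mulr0.
  by rewrite ler_pdivrMr ?mul1r// lt_def s0 (le_trans (p0 i)).
have s0 : s <= 1 by have := p0 i; lra.
have t0 : 0 <= p i / (1 - s) by rewrite divr_ge0// subr_ge0.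
have := IH _ (Sconv _ _ _ Sw (Sv i) t0 t1) s0; rewrite -/s.
congr S; rewrite scalerDr !scalerA mulrBr mulr1 pE addrA.
rewrite [in RHS](addrC (p i *: _)) [in RHS]addrAC.
by congr (_ + _ *: _ + _); ring.
Qed.

End convex_combinations.

Section convex_lipschitz.
Context {R : realType} {Y : normedModType R} {F : Y -> R}.
Hypothesis Fconvex : forall x y (t : R), 0 <= t -> t <= 1 ->
  F ((1 - t) *: x + t *: y) <= (1 - t) * F x + t * F y.

(** The upper bound is asked near [a] only and [b] is arbitrary: this bounds [F] at a barycenter by
    its value at an affine combination of two others. *)
Lemma convex_lipschitz_at (m M r : R) (a b : Y) : 0 < r ->
  (forall y, m <= F y) -> (forall h, `|h| <= r -> F (a + h) <= M) ->
  F a - F b <= (M - m) / r * `|a - b|.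
Proof.
move=> r0 mF FM.
have [->|ab] := eqVneq a b; first by rewrite !subrr normr0 mulr0.
have n0 : 0 < `|a - b| by rewrite normr_gt0 subr_eq0.
set n := `|a - b| in n0 *.
(* [a] lies between [b] and the point [z] at distance [r] beyond [a] *)
pose z := a + (r / n) *: (a - b).
have nr0 : 0 < n + r by rewrite addr_gt0.
pose s := n / (n + r).
have s0 : 0 <= s by rewrite divr_ge0// ltW.
have s1 : s <= 1 by rewrite ler_pdivrMr// mul1r lerDl ltW.
have aE : a = (1 - s) *: b + s *: z.
  rewrite /z scalerDr scalerA addrA.
  have -> : s * (r / n) = 1 - s by rewrite /s; field; rewrite !gt_eqF.
  by rewrite scalerBr [RHS]addrC addrA subrK -scalerDl subrK scale1r.
have Fz : F z <= M.
  apply: FM; rewrite normrZ -/n ger0_norm ?divr_ge0 ?(ltW r0) ?(ltW n0)//.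
  by rewrite divfK ?gt_eqF.
have Fa : F a <= (1 - s) * F b + s * F z by rewrite {1}aE; exact: Fconvex.
have sle : s <= n / r.
  by rewrite /s ler_pM2l// lef_pV2 ?posrE// lerDr ltW.
have : F a - F b <= s * (M - m).
  apply: (@le_trans _ _ (s * (F z - F b))); first by move: Fa; lra.
  by rewrite ler_wpM2l// lerB.
move=> /le_trans; apply.
have Mm : 0 <= M - m by rewrite subr_ge0; exact: le_trans (mF z) Fz.
rewrite [leRHS](_ : _ = n / r * (M - m)); last by field; rewrite gt_eqF.
by rewrite ler_wpM2r.
Qed.

End convex_lipschitz.

(** A continuous [F] may be unbounded on balls of [Y]; compactness of the image of [f] yields a
    uniform radius and bound, both encoded by the single integer [N]. *)
Lemma compact_locally_bounded_above {R : realType} {T : topologicalType}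
    {Y : normedModType R} (f : T -> Y) (F : Y -> R) :
  compact [set: T] -> continuous f -> continuous F ->
  exists N : nat, forall x h, `|h| < N.+1%:R^-1 -> F (f x + h) <= N%:R.
Proof.
move=> cT fc Fc.
have /compact_near_coveringP/(_ nat \oo
  (fun n x => forall h, `|h| < n.+1%:R^-1 -> F (f x + h) <= n%:R)) := cT.
case=> [x _|N _ NP]; last by exists N => x h; exact: (NP N (leqnn N) x I).
have : \forall y \near f x, F y < F (f x) + 1.
  by apply: (@cvgr_lt _ _ _ _ F (F (f x))); [exact: Fc|rewrite ltrDl].
move=> /nbhs_ballP[e /= e0 eF].
have e2 : 0 < e / 2 by rewrite divr_gt0.
near=> x' n => /= h hn.
apply: (@le_trans _ _ (F (f x) + 1)); last by near: n; exact: nbhs_infty_ger.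
rewrite ltW//; apply: eF; rewrite -ball_normE/= opprD addrA.
apply: le_lt_trans (ler_normB _ _) _; rewrite (splitr e) ltrD//.
  by near: x'; move/cvgrPdist_lt : (fc x); apply.
apply: lt_trans hn _.
by near: n; exact: (near_infty_natSinv_lt (PosNum e2)).
Unshelve. all: by end_near. Qed.

(** * The lifted space *)

(** A proper filter on the subtype is pushed forward to [X], where it clusters at a point of [A];
    open sets of the subtype are traces of open sets of [X]. *)
Lemma compact_set_type {X : topologicalType} (A : set X) :
  compact A -> compact [set: A].
Proof.
move=> cA G PG _.
have GA : (set_val @ G) A.
  by apply: (@filterS _ G _ setT) => [x _|]; [exact: set_mem (valP x)|exact: filterT].
have [p [Ap pG]] := cA _ (fmap_proper_filter set_val PG) GA.
exists (exist _ p (mem_set Ap)); split => // U V GU.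
rewrite nbhsE => -[_ [[W oW <-] /= Wp] WV].
have [|x [[u Uu ux] Wx]] := pG (set_val @` U) W _ (open_nbhs_nbhs (conj oW Wp)).
  by apply: (@filterS _ G _ U) => // u Uu; exists u.
by exists u; split => //; apply: WV => /=; rewrite ux.
Qed.

(** Minkowski's inequality in the plane; the Cauchy-Schwarz step [cs] follows from Lagrange's
    identity, with gap [(a1 * b2 - a2 * b1) ^+ 2]. *)
Lemma sqrt_add_sqr_triangle {R : rcfType} (a b a1 b1 a2 b2 : R) :
  0 <= a -> 0 <= b -> 0 <= a1 -> 0 <= b1 -> 0 <= a2 -> 0 <= b2 ->
  a <= a1 + a2 -> b <= b1 + b2 ->
  Num.sqrt (a ^+ 2 + b ^+ 2) <=
  Num.sqrt (a1 ^+ 2 + b1 ^+ 2) + Num.sqrt (a2 ^+ 2 + b2 ^+ 2).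
Proof.
move=> a0 b0 a10 b10 a20 b20 aa bb.
set s1 := Num.sqrt (a1 ^+ 2 + b1 ^+ 2); set s2 := Num.sqrt (a2 ^+ 2 + b2 ^+ 2).
have s10 : 0 <= s1 by exact: sqrtr_ge0.
have s20 : 0 <= s2 by exact: sqrtr_ge0.
have s1E : s1 ^+ 2 = a1 ^+ 2 + b1 ^+ 2 by rewrite sqr_sqrtr// addr_ge0 ?sqr_ge0.
have s2E : s2 ^+ 2 = a2 ^+ 2 + b2 ^+ 2 by rewrite sqr_sqrtr// addr_ge0 ?sqr_ge0.
rewrite -[leRHS]ger0_norm ?addr_ge0// -sqrtr_sqr ler_wsqrtr//.
have cs : a1 * a2 + b1 * b2 <= s1 * s2.
  rewrite -ler_sqr ?nnegrE ?addr_ge0 ?mulr_ge0// exprMn s1E s2E.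
  by rewrite -subr_ge0 [leRHS](_ : _ = (a1 * b2 - a2 * b1) ^+ 2) ?sqr_ge0//; ring.
have aa2 : a ^+ 2 <= (a1 + a2) ^+ 2 by rewrite ler_sqr ?nnegrE ?addr_ge0.
have bb2 : b ^+ 2 <= (b1 + b2) ^+ 2 by rewrite ler_sqr ?nnegrE ?addr_ge0.
rewrite sqrrD s1E s2E; move: aa2 bb2; rewrite !sqrrD; lra.
Qed.

Section Omega_metric.
Context {R : realType} {C : normedModType R} {L : R} {L0 : 0 < L}.
Context {B : set (weak_star C)} {B0 : B !=set0} {dB : B -> B -> R}.
Hypothesis dB_metrizes : metrizes dB.
Local Notation Omega_L := (Omega L0 B0).
Local Notation dO := (@dOmega R C L L0 B B0 dB).
Implicit Types x y z : Omega_L.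

Let dBm : is_metric dB. Proof. by case: dB_metrizes. Qed.

Lemma dOmega_sqr x y : dO x y ^+ 2 = (coef x - coef y) ^+ 2 + dB x.2 y.2 ^+ 2.
Proof.
by rewrite sqr_sqrtr ?addr_ge0 ?sqr_ge0// real_normK ?num_real.
Qed.

Lemma dOmega_ge_coef x y : `|coef x - coef y| <= dO x y.
Proof. by rewrite -[leLHS]normr_id -sqrtr_sqr ler_wsqrtr// lerDl sqr_ge0. Qed.

Lemma dOmega_ge_atom x y : dB x.2 y.2 <= dO x y.
Proof.
have {1}<- : Num.sqrt (dB x.2 y.2 ^+ 2) = dB x.2 y.2.
  by rewrite sqrtr_sqr ger0_norm//; exact: metric_ge0.
by rewrite ler_wsqrtr// lerDr sqr_ge0.
Qed.

Lemma dOmega_is_metric : is_metric dO.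
Proof.
have [dB0 dBC dBD] := dBm.
split.
- move=> x y; split => [xy0|->]; last first.
    by rewrite /dOmega subrr (metric_refl dBm) normr0 expr0n/= addr0 sqrtr0.
  have cxy : coef x = coef y.
    have := dOmega_ge_coef x y; rewrite xy0 normr_le0 subr_eq0.
    by move/eqP.
  have axy : x.2 = y.2.
    have := dOmega_ge_atom x y; rewrite xy0 => le0.
    by apply/dB0/le_anti; rewrite le0; exact: metric_ge0.
  have cxy1 : x.1 = y.1 by exact: val_inj.
  by rewrite [x]surjective_pairing [y]surjective_pairing cxy1 axy.
- by move=> x y; rewrite /dOmega distrC dBC.
- move=> x y z; apply: sqrt_add_sqr_triangle;
    rewrite ?normr_ge0 ?(metric_ge0 dBm)//.
  by have := ler_normD (coef x - coef y) (coef y - coef z); rewrite addrA subrK.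
Qed.

Lemma nbhs_dOmega x (e : R) : 0 < e -> nbhs x [set y | dO x y < e].
Proof.
move=> e0; have e2 : 0 < e / 2 by rewrite divr_gt0.
have nc : nbhs x.1
    [set c : set_type `[0, L]%classic | `|\val x.1 - \val c| < e / 2].
  have := @initial_continuous _ _ (set_val : set_type `[0, L]%classic -> R) x.1.
  by move=> /cvgrPdist_lt/(_ _ e2).
have nu : nbhs x.2 [set u | dB x.2 u < e / 2].
  by have [_ ->] := dB_metrizes; exists (e / 2).
exists ([set c : set_type `[0, L]%classic | `|\val x.1 - \val c| < e / 2],
    [set u | dB x.2 u < e / 2]) => //.
move=> [c u] [/= cx ux].
have b0 := metric_ge0 dBm x.2 u.
have ac : `|coef x - coef ((c, u) : Omega_L)| < e / 2 by [].
rewrite -ltr_sqr ?nnegrE ?sqrtr_ge0 ?(ltW e0)// dOmega_sqr.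
have a2 : (coef x - coef ((c, u) : Omega_L)) ^+ 2 < (e / 2) ^+ 2.
  by rewrite -real_normK ?num_real// ltr_sqr ?nnegrE// ltW.
have b2 : dB x.2 u ^+ 2 < (e / 2) ^+ 2 by rewrite ltr_sqr ?nnegrE// ltW.
have e22 : e ^+ 2 = 4 * (e / 2) ^+ 2 by field.
rewrite e22; apply: lt_le_trans (ltrD a2 b2) _.
by have := sqr_ge0 (e / 2); lra.
Qed.

Lemma compact_Omega : compact B -> compact [set: Omega_L].
Proof.
move=> cB; rewrite -setXTT; apply: compact_setX; apply: compact_set_type => //.
exact: segment_compact.
Qed.

Lemma coef_itv x : 0 <= coef x <= L.
Proof. by have := set_mem (valP x.1); rewrite /= in_itv. Qed.

(** The excess in the product is the excess of the coefficients plus that of the atoms, both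
    nonnegative; as the sum vanishes, so does each. *)
Lemma dOmega_intermediate x z y (t : R) : 0 < t -> t < 1 ->
  dO x z = t * dO x y -> dO z y = (1 - t) * dO x y ->
  [/\ coef z = (1 - t) * coef x + t * coef y,
      dB x.2 z.2 = t * dB x.2 y.2 & dB z.2 y.2 = (1 - t) * dB x.2 y.2].
Proof.
move=> t0 t1 xz zy; have t'0 : 0 < 1 - t by rewrite subr_gt0.
have ex0 : dO x z ^+ 2 / t + dO z y ^+ 2 / (1 - t) = dO x y ^+ 2.
  by rewrite xz zy; field; rewrite !gt_eqF.
move: ex0; rewrite !dOmega_sqr => ex0.
have eB := excess_ge0 dBm x.2 z.2 y.2 t0 t1.
have eC := sqr_add_le (coef x - coef z) (coef z - coef y) t0 t1.
rewrite addrA subrK in eC.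
have [] := excess_le0 (d := dB) dBm t0 t1 (_ : excess t x.2 z.2 y.2 <= 0).
  by move: ex0 eC; rewrite /excess !mulrDl; clear; lra.
move=> -> ->; split => //.
have : (1 - t) * (coef x - coef z) = t * (coef z - coef y).
  apply: sqr_add_eq => //; rewrite addrA subrK.
  by move: ex0 eB; rewrite /excess !mulrDl; clear; lra.
lra.
Qed.

End Omega_metric.

(** [A P + h] is a finite convex combination of points close to the image of [f]: all quantized
    values are translated by the same small vector [A P - s + h]. Sublevel sets of [F] are
    convex. *)
Lemma convex_le_near_barycenter {dsp : measure_display}
    {T : measurableType dsp} {R : realType} {d : T -> T -> R}
    {Y : normedModType R} (f : T -> Y) (A : probability T R -> Y) (C M r : R)
    (F : Y -> R) :
  quantizable (d := d) -> 0 < C -> 0 < r -> barycentric (d := d) f A C ->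
  (forall x y (t : R), 0 <= t -> t <= 1 ->
    F ((1 - t) *: x + t *: y) <= (1 - t) * F x + t * F y) ->
  (forall x h, `|h| < r -> F (f x + h) <= M) ->
  forall P h, `|h| <= r / 2 -> F (A P + h) <= M.
Proof.
move=> dq C0 r0 fA Fconvex FM P h hr.
(* With this mesh the quantization error is at most [r / 4], and [r / 4 + r / 2 < r]. *)
have [|n [q [y qy]]] := dq (r / 4 / C); first by rewrite !divr_gt0.
have := fA P n q y _ qy; rewrite mulrC divfK ?gt_eqF//.
set s := \sum_i _ => As.
have hs : `|A P - s + h| < r.
  by apply: le_lt_trans (ler_normD _ _) _; move: As hr r0; clear; lra.
have Sconv x z (t : R) : F x <= M -> F z <= M -> 0 <= t -> t <= 1 ->
    F ((1 - t) *: x + t *: z) <= M.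
  move=> xM zM t0 t1; apply: le_trans (Fconvex _ _ _ t0 t1) _.
  have -> : M = (1 - t) * M + t * M by ring.
  by rewrite lerD// ler_wpM2l// subr_ge0.
have := @convex_combination_in _ _ [set v | F v <= M] _ (index_enum 'I_n)
  (fun i => cell_mass (q := q) P i) (fun i => f (y i) + (A P - s + h))
  (f point + (A P - s + h)) Sconv.
rewrite /= (cell_mass_sum qy.1) subrr scale0r addr0.
have -> : \sum_i cell_mass (q := q) P i *: (f (y i) + (A P - s + h)) = A P + h.
  under eq_bigr do rewrite scalerDr.
  rewrite big_split/= -scaler_suml (cell_mass_sum qy.1) scale1r -/s.
  by rewrite addrA addrCA subrr addr0.
by apply => // [i|i|]; [exact: cell_mass_ge0|exact: FM|exact: FM].
Qed.

(** * Second differences of the lifted maps and convexity of the objective *)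

Section lifted_functional.
Context {R : realType} {C : normedModType R} {Y : hilbertType R}.
Context {K : weak_star C -> Y}.
Context {L : R} {L0 : 0 < L}.
Context {B : set (weak_star C)} {B0 : B !=set0} {dB : B -> B -> R} {c : R}.
Hypothesis B_compact : compact B.
Hypothesis dB_metrizes : metrizes dB.
Hypothesis dB_geodesic : geodesic_space dB.
Hypothesis c0 : 0 < c.
Hypothesis Kd : forall u : R -> B, geodesic dB u ->
  exists2 v1 : R -> Y, weak_derivative (fun t => K (\val (u t))) v1 &
  exists2 v2 : R -> Y, weak_derivative v1 v2 &
  forall t : R, t \in `[0, 1] ->
    `|v1 t| <= c * dB (u 0) (u 1) /\ `|v2 t| <= c * dB (u 0) (u 1) ^+ 2.

Local Notation Omega_L := (Omega L0 B0).
Local Notation dO := (@dOmega R C L L0 B B0 dB).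
Implicit Types x y z : Omega_L.

Definition lift x : Y := coef x ^+ 2 *: K (atom x).

Let dBm : is_metric dB. Proof. by case: dB_metrizes. Qed.
Let dOm := dOmega_is_metric (L0 := L0) (B0 := B0) dB_metrizes.
Let dOnbhs := nbhs_dOmega (L0 := L0) (B0 := B0) dB_metrizes.
Let Ocompact := compact_Omega (L0 := L0) (B0 := B0) B_compact.

Lemma atom_image_lipschitz x y :
  `|K (atom x) - K (atom y)| <= c * dB x.2 y.2.
Proof.
exact: (weak_derivative_along_geodesics_lipschitz (k := fun u : B => K (\val u))
  dB_geodesic Kd).
Qed.

Lemma atom_image_bounded : exists2 M, 0 <= M & forall x, `|K (atom x)| <= M.
Proof.
have [D dD] := compact_metric_bounded dOm dOnbhs Ocompact.
have x0 : Omega_L by exact: point.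
exists (`|K (atom x0)| + c * `|D|) => [|x].
  by rewrite addr_ge0// mulr_ge0// ltW.
rewrite -(subrK (K (atom x0)) (K (atom x))) addrC.
apply: le_trans (ler_normD _ _) _; rewrite lerD2l.
apply: le_trans (atom_image_lipschitz _ _) _; rewrite ler_wpM2l ?(ltW c0)//.
apply: le_trans (dOmega_ge_atom dB_metrizes _ _) _.
exact: le_trans (dD _ _) (ler_norm _).
Qed.

Lemma sqr_coef_lipschitz x y :
  `|coef x ^+ 2 - coef y ^+ 2| <= 2 * L * `|coef x - coef y|.
Proof.
have /andP[x0 xL] := coef_itv x; have /andP[y0 yL] := coef_itv y.
rewrite subr_sqr normrM mulrC ler_wpM2r//.
by rewrite ger0_norm ?addr_ge0// mulr_natl mulr2n lerD.
Qed.

Lemma lift_lipschitz : exists2 M, 0 < M &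
  forall x y, `|lift x - lift y| <= M * dO x y.
Proof.
have [N N0 KN] := atom_image_bounded.
exists (2 * L * N + L ^+ 2 * c) => [|x y].
  by rewrite ltr_wpDl ?mulr_ge0 ?(ltW L0)// mulr_gt0// exprn_gt0.
have -> : lift x - lift y = (coef x ^+ 2 - coef y ^+ 2) *: K (atom x) +
    coef y ^+ 2 *: (K (atom x) - K (atom y)).
  by rewrite /lift scalerBl scalerBr addrA subrK.
apply: le_trans (ler_normD _ _) _.
rewrite (normrZ (_ - _)) (normrZ (coef y ^+ 2)) mulrDl.
have /andP[y0 yL] := coef_itv y.
apply: lerD.
  rewrite mulrAC; apply: ler_pM => //.
  apply: le_trans (sqr_coef_lipschitz _ _) _.
  rewrite ler_wpM2l ?mulr_ge0 ?(ltW L0)//.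
  exact: (dOmega_ge_coef (dB := dB)).
rewrite -mulrA; apply: ler_pM => //.
  by rewrite ger0_norm ?sqr_ge0// ler_sqr ?nnegrE// ltW.
apply: le_trans (atom_image_lipschitz _ _) _; rewrite ler_wpM2l ?(ltW c0)//.
exact: dOmega_ge_atom.
Qed.

Lemma lift_second_difference : exists2 M, 0 <= M &
  forall (t : R) x z y, 0 < t -> t < 1 ->
  dO x z = t * dO x y -> dO z y = (1 - t) * dO x y ->
  `|lift z - (1 - t) *: lift x - t *: lift y| <= M * (t * (1 - t)) * dO x y ^+ 2.
Proof.
have [N N0 KN] := atom_image_bounded.
exists (N + 2 * L * c + L ^+ 2 * c) => [|t x z y t0 t1 xz zy].
  by rewrite !addr_ge0// ?mulr_ge0 ?sqr_ge0// ltW.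
have [cz xz' zy'] := dOmega_intermediate dB_metrizes t0 t1 xz zy.
have /andP[x0 xL] := coef_itv x; have /andP[y0 yL] := coef_itv y.
rewrite dOmega_sqr [in lift z]/lift cz.
apply: scaled_second_difference => //.
- exact: ltW.
- exact: metric_ge0.
- by rewrite distrC -xz'; exact: atom_image_lipschitz.
- by rewrite -zy'; exact: atom_image_lipschitz.
- exact: (weak_derivative_along_geodesics_second_difference
    (k := fun u : B => K (\val u)) dBm dB_geodesic Kd).
Qed.

Lemma sqr_coef_second_difference (t : R) x z y : 0 < t -> t < 1 ->
  dO x z = t * dO x y -> dO z y = (1 - t) * dO x y ->
  `|coef z ^+ 2 - (1 - t) * coef x ^+ 2 - t * coef y ^+ 2| <=
    t * (1 - t) * dO x y ^+ 2.
Proof.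
move=> t0 t1 xz zy; have [-> _ _] := dOmega_intermediate dB_metrizes t0 t1 xz zy.
have t'0 : 0 < 1 - t by rewrite subr_gt0.
rewrite [X in `|X|](_ : _ = - (t * (1 - t) * (coef x - coef y) ^+ 2)); last by ring.
have tt0 : 0 <= t * (1 - t) by rewrite mulr_ge0 ?(ltW t0) ?(ltW t'0).
rewrite normrN ger0_norm ?(mulr_ge0 tt0 (sqr_ge0 _))// ler_wpM2l//.
rewrite dOmega_sqr lerDl.
exact: sqr_ge0.
Qed.

Lemma objective_convex_along_geodesics (F : Y -> R) (m : R) :
  (forall y : Y, m <= F y) -> continuous F ->
  (forall (x y : Y) (t : R), 0 <= t -> t <= 1 ->
    F ((1 - t) *: x + t *: y) <= (1 - t) * F x + t * F y) ->
  exists2 lambda : R, lambda <= 0 &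
    convex_along_geodesics (@W2 R C L L0 B B0 dB) lambda (objective K F).
Proof.
move=> mF Fcont Fconvex.
pose T := borel_Omega L0 B0.
have [D dD] := compact_metric_bounded dOm dOnbhs Ocompact.
have dq : quantizable (T := T) (d := dO).
  exact: compact_metric_quantizable dOm dOnbhs Ocompact.
have [c1 c10 lift_lip] := lift_lipschitz.
have [M M0 lift_sd] := lift_second_difference.
have lift_cont := lipschitz_continuous dOm dOnbhs lift_lip.
have Abar := barycentric_bochner_integral dq c10 lift_lip.
have coef_lip x y : `|coef x ^+ 2 - coef y ^+ 2| <= 2 * L * dO x y.
  apply: le_trans (sqr_coef_lipschitz _ _) _.
  rewrite ler_wpM2l ?mulr_ge0 ?(ltW L0)//.
  exact: (dOmega_ge_coef (dB := dB)).
have L20 : 0 < 2 * L by rewrite mulr_gt0.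
have sqr_coef_ge0 x : 0 <= coef x ^+ 2 by exact: sqr_ge0.
have abar := barycentric_Rintegral dq L20 sqr_coef_ge0 coef_lip.
have [N FN] := compact_locally_bounded_above Ocompact lift_cont Fcont.
have r0 : 0 < N.+1%:R^-1 :> R by rewrite invr_gt0.
have FA := convex_le_near_barycenter dq c10 r0 Abar Fconvex FN.
have r20 : 0 < N.+1%:R^-1 / 2 :> R by rewrite divr_gt0.
(* Lipschitz constant of [F] at barycenters, where [F] is at most [N] on balls of half the radius
   obtained by compactness and at least [m] everywhere. *)
pose l := (N%:R - m) / (N.+1%:R^-1 / 2).
have l0 : 0 <= l.
  rewrite divr_ge0 ?(ltW r20)// subr_ge0; apply: le_trans (mF _) (FN point 0 _).
  by rewrite normr0.
(* [l * M] accounts for the term in [F] and [1] for the integral of the squared coefficient; the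
   factor 2 cancels the half in [convex_along_geodesics]. *)
exists (- (2 * (l * M + 1))).
  by rewrite oppr_le0 mulr_ge0// addr_ge0// mulr_ge0.
move=> g geo t; rewrite in_itv/= => /andP[t0 t1].
(* The endpoints are treated apart, as the excess divides by [t] and [1 - t]. *)
have [->|tn0] := eqVneq t 0.
  by rewrite subr0 mul1r !mul0r mulr0 !mul0r subr0 addr0.
have [->|tn1] := eqVneq t 1.
  by rewrite subrr mul0r mul1r mulr0 mul0r subr0 add0r.
have {tn0}t0 : 0 < t by rewrite lt_def tn0.
have {tn1}t1 : t < 1 by rewrite lt_neqAle tn1.
have t'0 : 0 < 1 - t by rewrite subr_gt0.
have tt0 : 0 <= t * (1 - t) by rewrite mulr_ge0 ?(ltW t0) ?(ltW t'0).
pose A (nu : P2 L0 B0) := bochner_integral nu (lift : borel_Omega L0 B0 -> Y).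
pose a (nu : P2 L0 B0) : R := \int[nu]_x (coef (x : Omega_L) ^+ 2).
have objE nu : objective K F nu = F (A nu) + a nu by [].
rewrite !objE {objE}.
set w := W2 dB (g 0) (g 1).
have W0t : W2 dB (g 0) (g t) = t * w.
  by rewrite geo ?in_itv/= ?lexx ?ler01 ?(ltW t0) ?(ltW t1)// sub0r normrN gtr0_norm.
have Wt1 : W2 dB (g t) (g 1) = (1 - t) * w.
  rewrite geo ?in_itv/= ?lexx ?ler01 ?(ltW t0) ?(ltW t1)// distrC.
  by rewrite gtr0_norm.
have A_sd : `|A (g t) - (1 - t) *: A (g 0) - t *: A (g 1)| <=
    M * (t * (1 - t)) * w ^+ 2.
  apply: (barycenter_second_difference (T := borel_Omega L0 B0) dOm dD dq Abar) => //.
    by rewrite mulr_ge0.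
  apply: (excess_relaxation dOm dOnbhs Ocompact lift_lip t0 t1) => x z y xz zy.
  exact: lift_sd.
have a_sd : `|a (g t) - (1 - t) * a (g 0) - t * a (g 1)| <=
    t * (1 - t) * w ^+ 2.
  apply: (barycenter_second_difference (T := borel_Omega L0 B0) (V := R^o)
    dOm dD dq abar) => //.
  apply: (excess_relaxation (V := R^o) dOm dOnbhs Ocompact coef_lip t0 t1).
  move=> x z y xz zy.
  exact: sqr_coef_second_difference.
(* The Lipschitz bound at [A (g t)] compares it with the affine combination of [A (g 0)] and
   [A (g 1)], at which convexity of [F] applies. *)
have FAt : F (A (g t)) <= (1 - t) * F (A (g 0)) + t * F (A (g 1)) +
    l * (M * (t * (1 - t)) * w ^+ 2).
  have := convex_lipschitz_at Fconvex ((1 - t) *: A (g 0) + t *: A (g 1))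
    r20 mF (FA (g t)).
  rewrite -/l opprD addrA => Fl.
  have := ler_wpM2l l0 A_sd => /(le_trans Fl).
  have := Fconvex (A (g 0)) (A (g 1)) t (ltW t0) (ltW t1).
  set x1 := (1 - t) * F _; set x2 := t * F _; set x3 := l * _.
  by move=> Fab Fl'; rewrite -lerBlDl; apply: le_trans Fl';
    rewrite lerD2l lerN2.
have {}a_sd : a (g t) <= (1 - t) * a (g 0) + t * a (g 1) + t * (1 - t) * w ^+ 2.
  move: a_sd; rewrite ler_norml => /andP[_].
  by rewrite !lerBlDr addrC -addrA [t * _ + _]addrC addrA.
apply: le_trans (lerD FAt a_sd) _.
by rewrite le_eqVlt; apply/orP; left; apply/eqP; field.
Qed.

End lifted_functional.

Theorem proposition4p10 (R : realType)
  (C : completeNormedModType R)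
  (C_separable : exists2 D : set C, countable D & dense D)
  (Y : hilbertType R)
  (K : weak_star C -> Y) (F : Y -> R) (Reg : weak_star C -> \bar R)
  (Reg_ge0 : forall u, (0 <= Reg u)%E)
  (B : set (weak_star C)) (B0 : B !=set0)
  (B_closed : closed B)
  (B_sub : B `<=` closure (extreme_points [set u | (Reg u <= 1)%E]))
  (dB : B -> B -> R)
  (dB_metrizes : metrizes dB)
  (dB_geodesic : geodesic_space dB)
  (A1_linear : linear K)
  (A1_continuous : weak_star_to_weak_continuous K)
  (A2_bounded : exists m : R, forall y, m <= F y)
  (A2_convex : convex_function [set: Y] F)
  (A2_differentiable : twice_differentiable F)
  (A3_convex : forall (u v : weak_star C) (t : R), t \in `[0, 1] ->
     (Reg ((1 - t) *: u + t *: v)%R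
        <= (1 - t)%:E * Reg u + t%:E * Reg v)%E)
  (A3_lsc : lower_semicontinuous Reg)
  (A3_homogeneous : forall (u : weak_star C) (a : R), 0 <= a ->
     Reg (a *: u) = (a%:E * Reg u)%E)
  (A4 : forall a : R, 0 <= a -> compact [set u | (Reg u <= a%:E)%E])
  (A5 : forall (u : nat -> weak_star C) (v : weak_star C),
     (forall n, (Reg (u n) < +oo)%E) -> (Reg v < +oo)%E ->
     u n @[n --> \oo] --> v -> K (u n) @[n --> \oo] --> K v)
  (A6 : forall (n : nat) (a : 'I_n -> R) (u : 'I_n -> weak_star C),
     (forall j, 0 <= a j) -> (forall j, B (u j)) ->
     Reg (\sum_(j < n) a j *: u j) = (\sum_(j < n) (a j)%:E * Reg (u j))%E)
  (A7 : ~ B 0)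
  (A8 : exists2 c : R, 0 < c & forall u : R -> B, geodesic dB u ->
     exists2 v1 : R -> Y, weak_derivative (fun t => K (\val (u t))) v1 &
     exists2 v2 : R -> Y, weak_derivative v1 v2 &
     forall t : R, t \in `[0, 1] ->
       `|v1 t| <= c * dB (u 0) (u 1) /\ `|v2 t| <= c * dB (u 0) (u 1) ^+ 2) :
  forall (L : R) (L0 : 0 < L), exists2 lambda : R, lambda <= 0 &
    convex_along_geodesics (@W2 R C L L0 B B0 dB) lambda (objective K F).
Proof.
move=> L L0.
have sub_closed : closed [set u | (Reg u <= 1)%E].
  rewrite -openC (_ : ~` _ = [set u | (1%:E < Reg u)%E]).
    by move/lower_semicontinuousP : A3_lsc; apply.
  by apply/seteqP; split => u /=; rewrite ltNge => /negP.
(* The unit sublevel set of [Reg] is closed and contains its extreme points, hence their closure and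
   [B]; it is compact by (A4). *)
have B_compact : compact B.
  apply: (subclosed_compact B_closed (A4 _ ler01)).
  by apply: subset_trans B_sub _; rewrite closureE; apply: smallest_sub => // v [].
have [m mF] := A2_bounded.
have [c c0 Kd] := A8.
apply: (objective_convex_along_geodesics B_compact dB_metrizes dB_geodesic c0 Kd mF).
  have [dF dFP] := A2_differentiable => y.
  by apply: differentiable_continuous; have [[]] := dFP y.
move=> x y t t0 t1.
(* [conv] puts the weight [t] on its first argument, hence the exchange of [x] and [y]. *)
have := A2_convex (Itv01 t0 t1) y x; rewrite !inE => /(_ I I).
by rewrite /conv/= addrC [X in _ <= X -> _]addrC.
Qed.
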